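(* Let $N\ge 0$ be an integer, $0<\mu\le L$, $0\le\rho<1$, and let $\alpha,\beta_0,\dots,\beta_N,\gamma_0,\dots,\gamma_N\in\mathbb{R}$ be step-sizes with $\alpha\neq 0$, $\gamma_0\neq 0$ and $\sum_{j=0}^N\beta_j=\sum_{j=0}^N\gamma_j=1$. Consider applying the first-order iterative fixed-step method of degree $N$ with these step-sizes to smooth strongly convex functions $f\in\mathcal{F}_{\mu,L}(\mathbb{R}^d)$. Then there exists a quadratic Lyapunov function of the form $$\mathcal{V}(\xi_k)=\begin{bmatrix}\mathbf{x}_k\\ \mathbf{g}_k\end{bmatrix}^{T}(P\otimes I_d)\begin{bmatrix}\mathbf{x}_k\\ \mathbf{g}_k\end{bmatrix}+p^{T}\mathbf{f}_k,\qquad k\ge N,$$ with parameters $P\in\mathbb{S}^{2(N+1)}$, $p\in\mathbb{R}^{N+1}$ and with rate $\rho$, that is valid for all $d\in\mathbb{N}$, if and only if the following semidefinite program ($\rho$-SDP) is feasible: there exist $P\in\mathbb{S}^{2(N+1)}$, $p\in\mathbb{R}^{N+1}$, real numbers $\lambda_{ij}\ge 0$ for $i,j\in\mathcal{I}_N$ and real numbers $\eta_{ij}\ge 0$ for $i,j\in\mathcal{I}_{N+1}$ such that $$0\prec V_N^{(N)}-\sum_{i,j\in\mathcal{I}_N}\lambda_{ij}M_{ij}^{(N)},\qquad 0< v_N^{(N)}-\sum_{i,j\in\mathcal{I}_N}\lambda_{ij}m_{ij}^{(N)},$$ $$0\succeq \Delta V_N^{(N+1)}+\sum_{i,j\in\mathcal{I}_{N+1}}\eta_{ij}M_{ij}^{(N+1)},\qquad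 0\ge \Delta v_N^{(N+1)}+\sum_{i,j\in\mathcal{I}_{N+1}}\eta_{ij}m_{ij}^{(N+1)},$$ where vector inequalities are componentwise and $V,v,\Delta V,\Delta v$ (which depend linearly on $P,p$), $M_{ij}$, $m_{ij}$ are defined in the context.
   Context: Function class. $\mathcal{F}_{\mu,L}(\mathbb{R}^d)$ is the set of differentiable $f:\mathbb{R}^d\to\mathbb{R}$ whose gradient is $L$-Lipschitz and such that $f-\frac{\mu}{2}\|\cdot\|^2$ is convex. Such an $f$ (with $\mu>0$) has a unique minimizer $x_\star$; put $f_\star=f(x_\star)$, $g_\star=\nabla f(x_\star)=0$. Method. The first-order iterative fixed-step method of degree $N$ with step-sizes $\alpha,\beta_j,\gamma_j$ and arbitrary initial conditions $x_{-N},\dots,x_0\in\mathbb{R}^d$ is, for $k\ge0$, $y_k=\sum_{j=0}^N\gamma_j x_{k-j}$, $x_{k+1}=\sum_{j=0}^N\beta_j x_{k-j}-\alpha\nabla f(y_k)$. Put $g_k=\nabla f(y_k)$, $f_k=f(y_k)$. State. For $k\ge N$: $\mathbf{x}_k=[(x_k-x_\star)^T\ \cdots\ (x_{k-N}-x_\star)^T]^T\in\mathbb{R}^{(N+1)d}$, $\mathbf{g}_k=[(g_k-g_\star)^T\ \cdots\ (g_{k-N}-g_\star)^T]^T\in\mathbb{R}^{(N+1)d}$, $\mathbf{f}_k=[f_k-f_\star\ \cdots\ f_{k-N}-f_\star]^T\in\mathbb{R}^{N+1}$, and the state is $\xi_k=(\mathbf{x}_k,\mathbf{g}_k,\mathbf{f}_k)$.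 The fixed point is $\xi_\star=(0,0,0)$. Lyapunov function. A Lyapunov function with rate $\rho$ is a continuous real-valued function $\mathcal{V}$ of the state $\xi$ that satisfies: (1) $\mathcal{V}(\xi)\ge0$ for all $\xi$; (2) $\mathcal{V}(\xi)=0$ if and only if $\xi=\xi_\star$; (3) $\mathcal{V}(\xi)\to\infty$ as $\|\xi\|\to\infty$; (4) $\mathcal{V}(\xi_{k+1})\le\rho^2\,\mathcal{V}(\xi_k)$ for $k\ge N$. Here $\xi$ ranges over the states generated by the method applied to functions $f\in\mathcal{F}_{\mu,L}(\mathbb{R}^d)$ from arbitrary initial conditions. ''Valid for all $d\in\mathbb{N}$'' means that the same $P,p$ give a Lyapunov function with rate $\rho$ for every dimension $d$. Data of the SDP. $\mathbb{S}^n$ denotes real symmetric $n\times n$ matrices, $\otimes$ the Kronecker product, $\mathbf{e}_i$ the $i$-th unit vector of the appropriate dimension, and $\mathcal{I}_K=\{0,1,\dots,K,\star\}$. For $K\in\{N,N+1\}$ define row vectors $\bar x_k^{(K)}=\mathbf{e}_{k+N+1}^T\in\mathbb{R}^{N+K+2}$ for $k=-N,\dots,0$; $\bar g_k^{(K)}=\mathbf{e}_{k+N+2}^T\in\mathbb{R}^{N+K+2}$ and $\bar f_k^{(K)}=\mathbf{e}_{k+1}^T\in\mathbb{R}^{K+1}$ for $k=0,\dots,K$; $\bar y_\star^{(K)}=\bar g_\star^{(K)}=0\in\mathbb{R}^{N+K+2}$, $\bar f_\star^{(K)}=0\in\mathbb{R}^{K+1}$; and, for $k=0,\dots,K$, $\bar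 y_k^{(K)}=\sum_{j=0}^N\gamma_j\bar x_{k-j}^{(K)}$, $\bar x_{k+1}^{(K)}=\sum_{j=0}^N\beta_j\bar x_{k-j}^{(K)}-\alpha\bar g_k^{(K)}$. For $i,j\in\mathcal{I}_K$ define $m_{ij}^{(K)}=(L-\mu)(\bar f_i^{(K)}-\bar f_j^{(K)})^T\in\mathbb{R}^{K+1}$ and $$M_{ij}^{(K)}=\frac12\begin{bmatrix}\bar y_i^{(K)}\\ \bar y_j^{(K)}\\ \bar g_i^{(K)}\\ \bar g_j^{(K)}\end{bmatrix}^T M\begin{bmatrix}\bar y_i^{(K)}\\ \bar y_j^{(K)}\\ \bar g_i^{(K)}\\ \bar g_j^{(K)}\end{bmatrix}\in\mathbb{S}^{N+K+2},\qquad M=\begin{bmatrix}-\mu L&\mu L&\mu&-L\\ \mu L&-\mu L&-\mu&L\\ \mu&-\mu&-1&1\\ -L&L&1&-1\end{bmatrix}.$$ Let $\bar{\mathbf{x}}_k^{(K)},\bar{\mathbf{g}}_k^{(K)}\in\mathbb{R}^{(N+1)\times(N+K+2)}$ and $\bar{\mathbf{f}}_k^{(K)}\in\mathbb{R}^{(N+1)\times(K+1)}$ be the matrices with rows $\bar x_k^{(K)},\dots,\bar x_{k-N}^{(K)}$, resp. $\bar g_k^{(K)},\dots,\bar g_{k-N}^{(K)}$, resp. $\bar f_k^{(K)},\dots,\bar f_{k-N}^{(K)}$ (top to bottom). Define $$v_k^{(K)}=(\bar{\mathbf{f}}_k^{(K)})^Tp\in\mathbb{R}^{K+1},\qquad V_k^{(K)}=\begin{bmatrix}\bar{\mathbf{x}}_k^{(K)}\\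 \bar{\mathbf{g}}_k^{(K)}\end{bmatrix}^TP\begin{bmatrix}\bar{\mathbf{x}}_k^{(K)}\\ \bar{\mathbf{g}}_k^{(K)}\end{bmatrix}\in\mathbb{S}^{N+K+2},$$ $\Delta v_k^{(K)}=v_{k+1}^{(K)}-\rho^2v_k^{(K)}$ and $\Delta V_k^{(K)}=V_{k+1}^{(K)}-\rho^2V_k^{(K)}$.
   Formalization: The formal theorem assumes μ < L instead of μ ≤ L, and that β_N ≠ 0 or γ_N ≠ 0 (degree really N); in the excluded cases the SDP is always infeasible although quadratic Lyapunov functions can exist, so the stated equivalence fails. *)

(* Defs.v *)
From mathcomp Require Import all_boot all_order all_algebra.
From mathcomp Require Import all_classical all_reals all_analysis.
From mathcomp.real_closed Require Export mxtens.
Set Implicit Arguments.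
Unset Strict Implicit.
Unset Printing Implicit Defensive.
Import Order.TTheory GRing.Theory Num.Theory.
Import numFieldNormedType.Exports.
Local Open Scope classical_set_scope.
Local Open Scope ring_scope.

Definition quad (R : pzRingType) n (A : 'M[R]_n) (z : 'cV[R]_n) : R :=
  (z^T *m A *m z) 0 0.

Definition posdef (R : realType) n (A : 'M[R]_n) : Prop :=
  forall z : 'cV[R]_n, z != 0 -> 0 < quad A z.

Definition possemidef (R : realType) n (A : 'M[R]_n) : Prop :=
  forall z : 'cV[R]_n, 0 <= quad A z.

(* The Euclidean norm; the library norm on matrices is the sup norm, which
   induces the same topology and the same notion of differentiability. *)
Definition enorm (R : realType) d (x : 'cV[R]_d) : R :=
  Num.sqrt (\sum_i x i 0 ^+ 2).

Definition grad (R : realType) d (f : 'cV[R]_d -> R) (x : 'cV[R]_d) :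
  'cV[R]_d := \col_i 'D_(delta_mx i 0) f x.

Definition smooth_strongly_convex (R : realType) d (mu L : R)
    (f : 'cV[R]_d -> R) : Prop :=
  [/\ forall x, differentiable f x,
      forall x y, enorm (grad f x - grad f y) <= L * enorm (x - y)
    & convex_function [set: convex_lmodType 'cV[R]_d]
        (fun x => f x - mu / 2 * enorm x ^+ 2)].

Record method (R : Type) (N : nat) := Method {
  alpha : R;
  beta : 'I_N.+1 -> R;
  gamma : 'I_N.+1 -> R }.

(* Indices are shifted by N: the term [x n] of a sequence [x : nat -> _] of
   iterates is the iterate x_{n-N}, so that [x 0], ..., [x N] are the initial
   conditions x_{-N}, ..., x_0 and x_{k-j} is [x (N + k - j)].  The sequences
   (y_k), (g_k) and (f_k), which start at k = 0, are not shifted. *)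
Definition yseq (R : realType) N (m : method R N) (V : lmodType R)
    (x : nat -> V) (k : nat) : V :=
  \sum_(j < N.+1) gamma m j *: x (N + k - j)%N.

Definition iterates (R : realType) N (m : method R N) d
    (f : 'cV[R]_d -> R) (x : nat -> 'cV[R]_d) : Prop :=
  forall k, x (N + k).+1 =
    \sum_(j < N.+1) beta m j *: x (N + k - j)%N
    - alpha m *: grad f (yseq m x k).

Definition minimizer (R : realType) d (f : 'cV[R]_d -> R)
    (xs : 'cV[R]_d) : Prop := forall z, f xs <= f z.

(* The vector of R^{n d} with successive blocks u_0, ..., u_{n-1}. *)
Definition stack (R : Type) n d (u : 'I_n -> 'cV[R]_d) : 'cV[R]_(n * d) :=
  \col_r u (mxtens_unindex r).1 (mxtens_unindex r).2 0.

Notation stateT R N d :=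
  ('cV[R]_(N.+1 * d) * 'cV[R]_(N.+1 * d) * 'cV[R]_N.+1)%type.

(* Only meaningful for N <= k, since k - i is truncated. *)
Definition state (R : realType) N (m : method R N) d (f : 'cV[R]_d -> R)
    (xs : 'cV[R]_d) (x : nat -> 'cV[R]_d) (k : nat) : stateT R N d :=
  let y := yseq m x in
  (stack (fun i : 'I_N.+1 => x (N + k - i)%N - xs),
   stack (fun i : 'I_N.+1 => grad f (y (k - i)%N) - grad f xs),
   \col_(i < N.+1) (f (y (k - i)%N) - f xs)).

Definition run (R : realType) N (m : method R N) d (mu L : R)
    (f : 'cV[R]_d -> R) (xs : 'cV[R]_d) (x : nat -> 'cV[R]_d) : Prop :=
  [/\ smooth_strongly_convex mu L f, minimizer f xs & iterates m f x].

Definition generated (R : realType) N (m : method R N) d (mu L : R) :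
    set (stateT R N d) :=
  [set xi | exists f xs x k,
     [/\ run m mu L f xs x, (N <= k)%N & xi = state m f xs x k]].

Definition lyapunov (R : realType) N (m : method R N) d (mu L rho : R)
    (V : stateT R N d -> R) : Prop :=
  [/\ continuous V,
      (forall xi, generated m mu L xi -> 0 <= V xi),
      (forall xi, generated m mu L xi -> (V xi = 0 <-> xi = 0)),
      (forall A : R, exists B : R, forall xi, generated m mu L xi ->
         B < `|xi| -> A < V xi)
    & forall f xs x, run m mu L f xs x -> forall k, (N <= k)%N ->
        V (state m f xs x k.+1) <= rho ^+ 2 * V (state m f xs x k)].

(* [*t] is the Kronecker product; its index convention (i, l) |-> i d + l is
   the one used by [stack]. *)
Definition quad_lyapunov (R : realType) N d
    (P : 'M[R]_(N.+1 + N.+1)) (p : 'cV[R]_N.+1) (xi : stateT R N d) : R :=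
  let z : 'cV[R]_((N.+1 + N.+1) * d) :=
    castmx (esym (mulnDl N.+1 N.+1 d), erefl 1%N) (col_mx xi.1.1 xi.1.2) in
  quad (P *t (1%:M : 'M[R]_d)) z + (p^T *m xi.2) 0 0.

Definition lyapunov_exists (R : realType) N (m : method R N)
    (mu L rho : R) : Prop :=
  exists (P : 'M[R]_(N.+1 + N.+1)) (p : 'cV[R]_N.+1),
    P^T = P /\
    forall d : nat, lyapunov m mu L rho (@quad_lyapunov R N d P p).

(* Indexed from 0: [unit_row n i] is the transpose of e_{i+1}. *)
Definition unit_row (R : realType) n (i : nat) : 'rV[R]_n :=
  \row_(j < n) (j == i :> nat)%:R.

(* [idx K] is I_K = {0, ..., K, star}, with [None] for star. *)
Definition idx (K : nat) : finType := option 'I_K.+1.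

Definition gbar (R : realType) (N K k : nat) : 'rV[R]_(N + K + 2) :=
  unit_row R (N + K + 2) (N + k + 1).

Definition fbar (R : realType) (K k : nat) : 'rV[R]_K.+1 :=
  unit_row R K.+1 k.

(* [xbar_upto m K k n] is correct for n <= N + k; indices are shifted by N as
   for the iterates.  See [xbar_init] and [xbar_step]. *)
Fixpoint xbar_upto (R : realType) N (m : method R N) (K k : nat) :
    nat -> 'rV[R]_(N + K + 2) :=
  if k is k'.+1 then fun n =>
    if (n <= N + k')%N then xbar_upto m K k' n
    else \sum_(j < N.+1) beta m j *: xbar_upto m K k' (N + k' - j)%N
         - alpha m *: gbar R N K k'
  else unit_row R (N + K + 2).

Definition xbar (R : realType) N (m : method R N) (K n : nat) :
  'rV[R]_(N + K + 2) := xbar_upto m K n n.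

Lemma xbar_uptoE (R : realType) N (m : method R N) K k l n :
  (n <= N + k)%N -> (k <= l)%N -> xbar_upto m K l n = xbar_upto m K k n.
Proof.
move=> nk; elim: l => [|l IHl]; first by rewrite leqn0 => /eqP ->.
rewrite leq_eqVlt => /orP[/eqP ->//|]; rewrite ltnS => kl /=.
by rewrite (leq_trans nk) ?leq_add2l// IHl.
Qed.

Lemma xbar_init (R : realType) N (m : method R N) K n :
  (n <= N)%N -> xbar m K n = unit_row R (N + K + 2) n.
Proof. by move=> nN; rewrite /xbar (@xbar_uptoE _ _ _ _ 0) ?addn0. Qed.

Lemma xbar_step (R : realType) N (m : method R N) K k :
  xbar m K (N + k).+1 =
    \sum_(j < N.+1) beta m j *: xbar m K (N + k - j)%N
    - alpha m *: gbar R N K k.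
Proof.
rewrite /xbar (@xbar_uptoE _ _ _ _ k.+1) ?addnS// ?ltnS ?leq_addl//=.
rewrite ltnn; congr (_ - _); apply: eq_bigr => j _; congr (_ *: _).
have [jk|kj] := leqP j N; last by have := ltn_ord j; rewrite ltnS leqNgt kj.
case: (leqP k (N + k - j)) => h; first by rewrite (@xbar_uptoE _ _ _ _ k) ?leq_subr.
by rewrite (@xbar_uptoE _ _ _ _ (N + k - j) k) ?leq_addl// ltnW.
Qed.

Definition fbar_idx (R : realType) K (i : idx K) : 'rV[R]_K.+1 :=
  if i is Some k then fbar R K k else 0.

Definition gbar_idx (R : realType) N K (i : idx K) : 'rV[R]_(N + K + 2) :=
  if i is Some k then gbar R N K k else 0.

Definition ybar_idx (R : realType) N (m : method R N) K (i : idx K) :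
    'rV[R]_(N + K + 2) :=
  if i is Some k then yseq m (xbar m K) k else 0.

Definition interp_mx (R : realType) (mu L : R) : 'M[R]_4 :=
  \matrix_(r < 4, c < 4) nth 0 (nth [::]
    [:: [:: - (mu * L);    mu * L;      mu;  - L ];
        [::    mu * L;  - (mu * L);   - mu;    L ];
        [::    mu;        - mu;        - 1;    1 ];
        [::  - L;            L;          1;  - 1 ]] r) c.

Definition Mij (R : realType) N (m : method R N) (mu L : R) K (i j : idx K) :
    'M[R]_(N + K + 2) :=
  let B := \matrix_(r < 4) nth 0
    [:: ybar_idx m i; ybar_idx m j; gbar_idx R N i; gbar_idx R N j] r in
  2^-1 *: (B^T *m interp_mx mu L *m B).

Definition mij (R : realType) (mu L : R) K (i j : idx K) : 'cV[R]_K.+1 :=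
  (L - mu) *: (fbar_idx R i - fbar_idx R j)^T.

(* As for [state], the block matrices are only meaningful for N <= k. *)
Definition xblock (R : realType) N (m : method R N) K k :
    'M[R]_(N.+1, N + K + 2) :=
  \matrix_(i < N.+1) xbar m K (N + k - i)%N.

Definition gblock (R : realType) N K k : 'M[R]_(N.+1, N + K + 2) :=
  \matrix_(i < N.+1) gbar R N K (k - i)%N.

Definition fblock (R : realType) N K k : 'M[R]_(N.+1, K.+1) :=
  \matrix_(i < N.+1) fbar R K (k - i)%N.

Definition vk (R : realType) N K k (p : 'cV[R]_N.+1) : 'cV[R]_K.+1 :=
  (fblock R N K k)^T *m p.

Definition Vk (R : realType) N (m : method R N) K k
    (P : 'M[R]_(N.+1 + N.+1)) : 'M[R]_(N + K + 2) :=
  let Z := col_mx (xblock m K k) (gblock R N K k) in Z^T *m P *m Z.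

Definition Deltav (R : realType) N K k (rho : R) (p : 'cV[R]_N.+1) :
    'cV[R]_K.+1 :=
  vk K k.+1 p - rho ^+ 2 *: vk K k p.

Definition DeltaV (R : realType) N (m : method R N) K k (rho : R)
    (P : 'M[R]_(N.+1 + N.+1)) : 'M[R]_(N + K + 2) :=
  Vk m K k.+1 P - rho ^+ 2 *: Vk m K k P.

Definition rho_SDP_feasible (R : realType) N (m : method R N)
    (mu L rho : R) : Prop :=
  exists (P : 'M[R]_(N.+1 + N.+1)) (p : 'cV[R]_N.+1)
      (lam : idx N -> idx N -> R) (eta : idx N.+1 -> idx N.+1 -> R),
    [/\ P^T = P, (forall i j, 0 <= lam i j) & (forall i j, 0 <= eta i j)] /\
    [/\ posdef (Vk m N N P
          - \sum_(i : idx N) \sum_(j : idx N) lam i j *: Mij m mu L i j),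
        (forall l, 0 < (vk N N p
          - \sum_(i : idx N) \sum_(j : idx N) lam i j *: mij mu L i j) l 0),
        possemidef (- (DeltaV m N.+1 N rho P
          + \sum_(i : idx N.+1) \sum_(j : idx N.+1)
              eta i j *: Mij m mu L i j))
      & (forall l, (Deltav N.+1 N rho p
          + \sum_(i : idx N.+1) \sum_(j : idx N.+1)
              eta i j *: mij mu L i j) l 0 <= 0)].

(* Main.v *)
(* Sufficiency: the SDP inequalities are summed against the interpolation
   inequalities [gap] (the coefficients of [gap] at the points y_i, y_j are the
   entries of M_ij and m_ij), which every smooth strongly convex function
   satisfies; the strict inequalities give V >= e (|x|^2 + |g|^2 + sum f).

   Necessity: conversely every Gram matrix and vector of values satisfying all
   the interpolation inequalities comes from a run of the method on some
   smooth strongly convex function, in dimension N + K + 2.  So V is positive,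
   and by compactness at least c (|Z|^2 + sum F), on the cone cut out by these
   inequalities, and V_+ - rho^2 V is nonpositive there.  Conic duality then
   yields the multipliers; Slater's condition holds because the method applied
   to f = c |x|^2 / 2 separates the points y_k for generic c. *)
Require Import Defs.
From HB Require Import structures.
From mathcomp Require Import all_boot all_order all_algebra.
From mathcomp Require Import all_classical all_reals all_analysis.
From mathcomp Require Import ring lra zify.
Set Implicit Arguments.
Unset Strict Implicit.
Unset Printing Implicit Defensive.
Import Order.TTheory GRing.Theory Num.Theory.
Import numFieldNormedType.Exports.
Local Open Scope classical_set_scope.
Local Open Scope ring_scope.

(** * Dot product, continuity and minimization *)

Section DotProduct.
Context {R : realType} {d : nat}.
Implicit Types (u v w : 'cV[R]_d) (a : R).

(** In the converse the Lyapunov property is used in just two dimensions, the number N + K + 2 of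
    rows of Z for K = N and K = N + 1: a square Z realizes every positive semidefinite Gram matrix,
    so the cone carries no rank constraint and is the one that duality needs.

    Two obstacles shape that direction. Positivity of V concerns the state at k = N, which contains
    x_0, ..., x_N but none of x_{-N}, ..., x_{-1}, although these are rows of Z; for V to be
    positive on the whole cone, a zero state must force Z = 0. This holds because the recurrences
    can be run backwards through beta_N or gamma_N. Next, duality only produces weak inequalities;
    the strict ones come from applying it to (V, v) - c (I, 1), with c the constant found by
    compactness. Since F is not sign constrained in the duality statement, the vector part even
    comes out as an equality.

    A single window suffices in the SDP because the coefficients of the method do not depend on k:
    every state is the state at time N of a delayed run. *)

Definition dot u v : R := \sum_i u i 0 * v i 0.

Lemma dotC u v : dot u v = dot v u.
Proof. by apply: eq_bigr => i _; rewrite mulrC. Qed.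

Lemma dotDl u v w : dot (u + v) w = dot u w + dot v w.
Proof. by rewrite -big_split; apply: eq_bigr => i _; rewrite mxE mulrDl. Qed.

Lemma dotZl a u w : dot (a *: u) w = a * dot u w.
Proof. by rewrite mulr_sumr; apply: eq_bigr => i _; rewrite mxE mulrA. Qed.

Lemma dotNl u w : dot (- u) w = - dot u w.
Proof. by rewrite -scaleN1r dotZl mulN1r. Qed.

Lemma dotBl u v w : dot (u - v) w = dot u w - dot v w.
Proof. by rewrite dotDl dotNl. Qed.

Lemma dot0l w : dot 0 w = 0.
Proof. by rewrite -(scale0r 0) dotZl mul0r. Qed.

Lemma dotDr u v w : dot w (u + v) = dot w u + dot w v.
Proof. by rewrite dotC dotDl !(dotC _ w). Qed.

Lemma dotZr a u w : dot w (a *: u) = a * dot w u.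
Proof. by rewrite dotC dotZl dotC. Qed.

Lemma dotNr u w : dot w (- u) = - dot w u.
Proof. by rewrite dotC dotNl dotC. Qed.

Lemma dotBr u v w : dot w (u - v) = dot w u - dot w v.
Proof. by rewrite dotDr dotNr. Qed.

Lemma dot0r w : dot w 0 = 0.
Proof. by rewrite dotC dot0l. Qed.

Lemma dot_suml (J : Type) (r : seq J) (P : pred J) (F : J -> 'cV[R]_d) w :
  dot (\sum_(j <- r | P j) F j) w = \sum_(j <- r | P j) dot (F j) w.
Proof. by apply: (big_morph (dot^~ w)) => [u v|]; rewrite (dotDl, dot0l). Qed.

Definition dotE := (dotDl, dotDr, dotNl, dotNr, dotZl, dotZr, dot0l, dot0r).

Lemma dot_ge0 u : 0 <= dot u u.
Proof. by apply: sumr_ge0 => i _; rewrite -expr2 sqr_ge0. Qed.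

Lemma dot_eq0 u : dot u u = 0 -> u = 0.
Proof.
move=> /psumr_eq0P u0; apply/matrixP => i j; rewrite ord1 mxE.
apply/eqP; rewrite -sqrf_eq0 expr2; apply/eqP.
by apply: u0 => // k _; rewrite -expr2 sqr_ge0.
Qed.

Lemma enorm_ge0 u : 0 <= enorm u.
Proof. exact: sqrtr_ge0. Qed.

Lemma enorm_sqr u : enorm u ^+ 2 = dot u u.
Proof.
rewrite sqr_sqrtr; first by apply: eq_bigr => i _; rewrite expr2.
by apply: sumr_ge0 => i _; rewrite sqr_ge0.
Qed.

Lemma ler_enorm a u v : 0 <= a ->
  (enorm u <= a * enorm v) = (dot u u <= a ^+ 2 * dot v v).
Proof.
move=> a0; rewrite -!enorm_sqr -exprMn ler_pXn2r// nnegrE ?mulr_ge0//;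
exact: enorm_ge0.
Qed.

Lemma dot_le a u v : 0 < a -> dot u u <= a ^+ 2 * dot v v ->
  dot u v <= a * dot v v.
Proof.
move=> a0 uv; have := dot_ge0 (u - a *: v).
by rewrite !dotE (dotC v u); nra.
Qed.

Lemma dot_delta u i : dot u (delta_mx i 0) = u i 0.
Proof.
rewrite /dot (bigD1 i)//= mxE !eqxx mulr1 big1 ?addr0// => j ji.
by rewrite mxE (negPf ji) mulr0.
Qed.

End DotProduct.

Lemma ler_mx_norm {R : realType} m n (x : 'M[R]_(m, n)) a :
  0 <= a -> (forall i j, `|x i j| <= a) -> `|x| <= a.
Proof.
move=> a0 xa; rewrite [leLHS]mx_normrE; apply/bigmax_leP; split => [//|ij _].
exact: xa.
Qed.

Lemma mx_norm_entry {R : realType} m n (x : 'M[R]_(m, n)) i j :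
  `|x i j| <= `|x|.
Proof.
rewrite [leRHS]mx_normrE; apply/bigmax_geP; right => /=.
by exists (i, j).
Qed.

Lemma dot_le_norm {R : realType} d (u : 'cV[R]_d) :
  dot u u <= d%:R * `|u| ^+ 2.
Proof.
apply: (@le_trans _ _ (\sum_(i < d) `|u| ^+ 2)).
  apply: ler_sum => i _; rewrite -expr2 -real_normK ?num_real//.
  by rewrite lerXn2r ?nnegrE ?mx_norm_entry.
by rewrite sumr_const card_ord mulr_natl.
Qed.

Section Continuity.
Context {R : realType} {T : topologicalType}.
Implicit Types f g : T -> R.

Lemma continuous_add f g : continuous f -> continuous g ->
  continuous (fun x => f x + g x).
Proof. by move=> cf cg x; apply: continuousD; [exact: cf|exact: cg]. Qed.

Lemma continuous_opp f : continuous f -> continuous (fun x => - f x).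
Proof. by move=> cf x; apply: continuousN; exact: cf. Qed.

Lemma continuous_mul f g : continuous f -> continuous g ->
  continuous (fun x => f x * g x).
Proof. by move=> cf cg x; apply: continuousM; [exact: cf|exact: cg]. Qed.

Lemma continuous_cst (a : R) : continuous (fun _ : T => a).
Proof. by move=> x; exact: cst_continuous. Qed.

Lemma continuous_sum (I : Type) (r : seq I) (P : pred I) (F : I -> T -> R) :
  (forall i, P i -> continuous (F i)) ->
  continuous (fun x => \sum_(i <- r | P i) F i x).
Proof.
by move=> cF x; apply: cvg_big => [|i Pi]; [exact: add_continuous|exact: cF].
Qed.

Lemma closed_sublevel f a : continuous f -> closed [set x | f x <= a].
Proof.
by move=> cf; apply: (@preimage_closed _ _ f [set y | y <= a]) => [x _|];
  [exact: cf|exact: closed_le].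
Qed.

Lemma closed_superlevel f a : continuous f -> closed [set x | a <= f x].
Proof.
by move=> cf; apply: (@preimage_closed _ _ f [set y | a <= y]) => [x _|];
  [exact: cf|exact: closed_ge].
Qed.

End Continuity.

Lemma argmin_rV {R : realType} n (A : set 'rV[R]_n) (f : 'rV[R]_n -> R)
    (x0 : 'rV[R]_n) (C : R) :
    continuous f -> closed A -> A x0 ->
    (forall x, A x -> f x <= f x0 -> forall i, `|x 0 i| <= C) ->
  exists2 x, A x & forall y, A y -> f x <= f y.
Proof.
move=> cf clA Ax0 bA; pose B := A `&` [set x | f x <= f x0].
have cB : compact B.
  apply: bounded_closed_compact; last first.
    by apply: closedI => //; exact: closed_sublevel.
  exists (Num.max 0 C); split; first exact: num_real.
  move=> M CM x [Ax fx]; apply: ler_mx_norm => [|i j].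
    by apply: le_trans (ltW CM); rewrite le_max lexx.
  rewrite ord1; apply: le_trans (bA _ Ax fx j) _.
  by apply: le_trans (ltW CM); rewrite le_max lexx orbT.
have [||x /set_mem[Ax fx] xmin] := EVT_min_rV _ cB (f := f).
- by exists x0; split => /=.
- exact: continuous_subspaceT.
exists x => // y Ay; have [yx0|/ltW x0y] := leP (f y) (f x0).
  by apply: xmin; rewrite inE; split.
exact: le_trans fx x0y.
Qed.

(** * Interpolation inequalities *)

Lemma diff_grad {R : realType} d (f : 'cV[R]_d -> R) x v :
  differentiable f x -> 'd f x v = dot (grad f x) v.
Proof.
move=> df; have {1}-> : v = \sum_i v i 0 *: delta_mx i 0.
  apply/matrixP => i j; rewrite ord1 summxE (bigD1 i)//= big1 => [|k ki].
    by rewrite !mxE !eqxx mulr1 addr0.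
  by rewrite !mxE eq_sym (negPf ki) mulr0.
rewrite linear_sum; apply: eq_bigr => i _.
by rewrite linearZ/= mxE deriveE// mulrC.
Qed.

Lemma is_derive_line {R : realType} d (f : 'cV[R]_d -> R) x v (t : R) :
  (forall z, differentiable f z) ->
  is_derive t 1 (fun s : R => f (x + s *: v)) (dot (grad f (x + t *: v)) v).
Proof.
move=> df; set a := x + t *: v.
have E : (fun h : R => h^-1 *: (((fun s : R => f (x + s *: v)) \o shift t)
      (h *: 1) - f (x + t *: v))) =
    (fun h => h^-1 *: ((f \o shift a) (h *: v) - f a)).
  apply/funext => h /=; rewrite /a scalerDl /GRing.scale/= mulr1.
  by rewrite (addrC x) -addrA (addrC _ x).
have /diff_derivable dfv := df a.
apply: DeriveDef; first by rewrite /derivable E; exact: dfv.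
by rewrite /derive E -diff_grad// -deriveE.
Qed.

Lemma convex_functionP {R : realType} d (f : 'cV[R]_d -> R) :
  convex_function [set: convex_lmodType 'cV[R]_d] f <->
  forall x y (t : R), 0 <= t <= 1 ->
    f (t *: x + (1 - t) *: y) <= t * f x + (1 - t) * f y.
Proof.
split=> [cf x y t /andP[t0 t1]|cf t x y _ _].
  exact: (cf (Itv01 t0 t1) x y (in_setT _) (in_setT _)).
by apply: cf; rewrite ge0 le1.
Qed.

(** The quadratic slack [t ^+ 2 * c] disappears from the right difference quotient as t tends to
    0. *)
Lemma is_derive_le {R : realType} (f : R -> R) (a b c : R) :
  is_derive (0 : R) (1 : R) f a ->
  (forall t, 0 < t <= 1 -> f t <= f 0 + t * b + t ^+ 2 * c) -> a <= b.
Proof.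
move=> fa fle.
have cvl : (fun h : R => h^-1 * (f h - f 0)) @ 0^'+ --> a.
  have := cvg_dnbhs_at_right (@ex_derive _ _ _ _ _ _ _ fa).
  rewrite -[lim _]/('D_1 f 0) derive_val; apply: cvg_trans.
  apply: near_eq_cvg; near=> h.
  by rewrite /= /GRing.scale/= mulr1 addr0.
have cvr : (fun h : R => b + h * c) @ 0^'+ --> b.
  apply: cvg_at_right_filter; rewrite -[X in _ --> X]addr0.
  apply: cvgD; first exact: cvg_cst.
  by rewrite -[X in _ --> X](mul0r c); apply: cvgM; [exact: cvg_id|exact: cvg_cst].
apply: ler_cvg_to cvl cvr _; near=> h.
have h0 : 0 < h by [].
have h1 : h <= 1 by near: h; exact: nbhs_right_le.
rewrite ler_pdivrMl// lerBlDl.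
by have := fle h; rewrite h0 h1 => /(_ isT); lra.
Unshelve. all: by end_near. Qed.

(** The interpolation inequality bounding a = f(x) from below by the data at y, for gradients u at x
    and v at y, multiplied by L - mu so that it becomes polynomial in mu and L. *)
Definition gap {R : realType} (mu L : R) d (x y u v : 'cV[R]_d) (a b : R) : R :=
  (L - mu) * (a - b) + dot (mu *: u - L *: v) (x - y)
  - (mu * L * dot (x - y) (x - y) + dot (u - v) (u - v)) / 2.

Section Necessity.
Context {R : realType} {d : nat} (mu L : R) (f : 'cV[R]_d -> R).
Hypothesis sf : smooth_strongly_convex mu L f.
Let df : forall x, differentiable f x. Proof. by case: sf. Qed.

Lemma strong_tangent x y :
  f x + dot (grad f x) (y - x) + mu / 2 * dot (y - x) (y - x) <= f y.
Proof.
have [_ _ /convex_functionP cf] := sf.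
pose v := y - x.
suff : dot (grad f x) v <= f y - f x - mu / 2 * dot v v by rewrite -/v; lra.
have D := is_derive_line x v 0 df; rewrite scale0r addr0 in D.
apply: (is_derive_le D (c := mu / 2 * dot v v)) => t /andP[t0 t1].
have /= := cf y x t; rewrite t1 (ltW t0) => /(_ isT).
rewrite !enorm_sqr scale0r addr0.
have -> : t *: y + (1 - t) *: x = x + t *: v.
  by rewrite /v scalerBr scalerBl scale1r addrCA addrC.
have -> : y = x + v by rewrite /v addrC subrK.
rewrite !dotE (dotC y x); lra.
Qed.

Lemma descent_bound x y : 0 < L ->
  f y <= f x + dot (grad f x) (y - x) + L / 2 * dot (y - x) (y - x).
Proof.
move=> L0; have [_ lf _] := sf; pose v := y - x.
pose a := dot (grad f x) v; pose b := L / 2 * dot v v.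
(* [phi] compares f along the segment with its quadratic upper model; the Lipschitz bound makes its
   derivative nonpositive on the interval. *)
pose phi := fun t : R => f (x + t *: v) - (t * a + t ^+ 2 * b).
have D (t : R) : is_derive (t : R) (1 : R) phi
    (dot (grad f (x + t *: v)) v - (a + t * L * dot v v)).
  have Df := is_derive_line x v t df.
  apply: is_derive_eq; rewrite /b /GRing.scale/=; lra.
have dphi t : derivable phi t 1 by have := D t; case.
have : phi 1 <= phi 0.
  apply: (@ler0_derive1_le_cc _ phi 0 1) => //; rewrite ?in_itv/= ?lexx ?ler01//.
  - move=> t; rewrite in_itv/= => /andP[t0 t1].
    rewrite derive1E (@derive_val _ _ _ _ _ _ _ (D t)).
    have := lf (x + t *: v) x; rewrite ler_enorm ?(ltW L0)//.
    rewrite [x + _ - x]addrC addKr.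
    rewrite !(dotZl, dotZr) => H.
    have Lt : 0 < L * t by rewrite mulr_gt0.
    have /(dot_le Lt) : dot (grad f (x + t *: v) - grad f x)
        (grad f (x + t *: v) - grad f x) <= (L * t) ^+ 2 * dot v v.
      by apply: le_trans H _; rewrite exprMn -!mulrA.
    by rewrite dotBl -/a; lra.
  - apply: derivable_within_continuous => t _; exact: dphi.
rewrite /phi !scale1r scale0r addr0 /a /b /v (addrC x) subrK; lra.
Qed.

Lemma gap_ge0 x y : 0 < L -> mu < L ->
  0 <= gap mu L x y (grad f x) (grad f y) (f x) (f y).
Proof.
move=> L0 muL; pose u := grad f x; pose v := grad f y; pose e := x - y.
(* The point x - c w minimizes, over z, the upper model of f at x minus the lower model at y. The
   first dominates f and the second is below f, so the difference [D] is nonnegative there, and it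
   is the gap divided by L - mu. *)
pose w := u - v - mu *: e; pose c := (L - mu)^-1.
have Lmu : L - mu != 0 by rewrite subr_eq0 gt_eqF.
have zx : x - c *: w - x = - (c *: w) by rewrite addrC addKr.
have zy : x - c *: w - y = e - c *: w by rewrite /e addrAC.
have := le_trans (strong_tangent y (x - c *: w)) (descent_bound x _ L0).
rewrite zx zy -/u -/v -subr_ge0; set D := (X in 0 <= X -> _) => D0.
rewrite (_ : gap _ _ _ _ _ _ _ _ = (L - mu) * D).
  by rewrite mulr_ge0// subr_ge0 ltW.
rewrite /gap /D -/u -/v -/e /w; clearbody u v e.
rewrite !dotE !(dotC v u) !(dotC e u) !(dotC e v) /c.
field; exact: Lmu.
Qed.

Lemma grad_minimizer x : 0 < L -> minimizer f x -> grad f x = 0.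
Proof.
move=> L0 xmin; apply: dot_eq0; apply/eqP; rewrite eq_le dot_ge0 andbT.
(* A gradient step of length 1/L would lower f by at least [g / L / 2]. *)
have := le_trans (xmin _) (descent_bound x (x - L^-1 *: grad f x) L0).
rewrite [x - _ - x]addrC addKr !dotE; set g := dot _ _.
rewrite (_ : _ + _ = f x - g / L / 2); last by field; rewrite gt_eqF.
rewrite lerBrDl gerDr => H; have : g / L <= 0 by lra.
by rewrite pmulr_lle0 ?invr_gt0.
Qed.

End Necessity.

(** * Smooth strongly convex interpolation *)

Lemma differentiable_littleo {R : realType} (V W : normedModType R)
    (f : V -> W) (df : {linear V -> W}) x : continuous df ->
    (forall e, 0 < e ->
      \forall v \near 0, `|f (x + v) - f x - df v| <= e * `|v|) ->
  differentiable f x /\ 'd f x = df :> (V -> W).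
Proof.
move=> cdf fo; have fE : f \o shift x = cst (f x) + df +o_ 0 id.
  apply/eqaddoP => e e0; apply: filterS (fo e e0) => v.
  by rewrite /= !fctE /= opprD addrA (addrC v x).
have dfE := diff_unique cdf fE.
by split=> //; apply/diff_locallyP; rewrite dfE; split.
Qed.

Lemma differentiable_quad_bound {R : realType} d (f : 'cV[R]_d -> R) x g C :
  (forall v, `|f (x + v) - f x - dot g v| <= C * dot v v) ->
  differentiable f x /\ grad f x = g.
Proof.
move=> fC; have lin : linear (dot g : 'cV[R]_d -> R).
  by move=> a u v; rewrite dotDr dotZr.
pose gM := GRing.isLinear.Build _ _ _ _ _ lin.
pose gL : {linear 'cV[R]_d -> R} := HB.pack (dot g) gM.
pose V : normedModType R := 'cV[R]_d.
have gc : continuous gL.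
  apply: continuous_sum => i _; apply: continuous_mul; first exact: continuous_cst.
  exact: coord_continuous.
have [e e0|df dfE] := @differentiable_littleo R _ _ f gL x gc.
  near=> v; apply: le_trans (fC v) _.
  (* The library norm is the sup norm, whence a factor d; [d.+1] keeps the constant positive when d
     = 0. *)
  have C0 : 0 < (`|C| + 1) * d.+1%:R by rewrite mulr_gt0// ltr_wpDl.
  apply: (@le_trans _ _ ((`|C| + 1) * d.+1%:R * `|v| * `|v|)).
    apply: (@le_trans _ _ ((`|C| + 1) * dot v v)).
      by rewrite ler_wpM2r ?dot_ge0// (le_trans (ler_norm C))// lerDl.
    rewrite -!mulrA ler_wpM2l ?addr_ge0// -expr2.
    apply: le_trans (dot_le_norm v) _.
    by rewrite ler_wpM2r ?exprn_ge0// ler_nat.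
  rewrite ler_wpM2r// -ler_pdivlMl//.
  near: v; apply: (@nbhs0_le R V); rewrite mulr_gt0 ?invr_gt0//.
split=> //; apply/matrixP => i j; rewrite ord1 mxE deriveE// dfE.
by rewrite /= dot_delta.
Unshelve. all: by end_near. Qed.

Lemma ler_contract {R : realType} (p q : R) :
  (forall t, 0 < t < 1 -> (1 - t) * q <= p) -> q <= p.
Proof.
move=> H; rewrite leNgt; apply/negP => pq.
have /H : 0 < (1 / 2 : R) < 1 by apply/andP; split; lra.
have [q0|q0 Hp] := leP q 0; first by nra.
(* With this t, (1 - t) q is the midpoint of p and q, which exceeds p. *)
have /H : 0 < (q - p) / (2 * q) < 1.
  by rewrite divr_gt0 ?subr_gt0 ?mulr_gt0//= ltr_pdivrMr ?mulr_gt0//; lra.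
have -> : (1 - (q - p) / (2 * q)) * q = (q + p) / 2.
  by field; rewrite gt_eqF.
lra.
Qed.

(** The hypotheses make m a maximum of finitely many affine functions, so adding |s|^2 / (2 k) gives
    a strongly convex function: it has a minimizer and grows quadratically away from it. *)
Lemma max_quad_argmin {R : realType} d (J : finType) (i0 : J) (k : R)
    (a : J -> R) (b : J -> 'cV[R]_d) (m : 'cV[R]_d -> R) : 0 < k ->
    continuous (fun u : 'rV[R]_d => m u^T) ->
    (forall s i, a i + dot (b i) s <= m s) ->
    (forall s, exists i, m s = a i + dot (b i) s) ->
  exists s0, forall s, m s0 + dot s0 s0 / (2 * k)
    + dot (s - s0) (s - s0) / (2 * k) <= m s + dot s s / (2 * k).
Proof.
move=> k0 cm mge mex; pose F s := m s + dot s s / (2 * k).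
have cF : continuous (fun u : 'rV[R]_d => F u^T).
  apply: continuous_add cm _; apply: continuous_mul; last exact: continuous_cst.
  apply: continuous_sum => i _; rewrite [X in continuous X](_ : _ =
    fun u : 'rV[R]_d => u 0 i * u 0 i); last by apply/funext => u; rewrite !mxE.
  by apply: continuous_mul; exact: coord_continuous.
(* Completing the square in F s <= F 0, with m bounded below by the piece i0, gives |s + k b_i0|^2
   <= Q. Coordinates are then bounded through |t| <= t^2 + 1. *)
pose Q := 2 * k * (m 0 - a i0) + k ^+ 2 * dot (b i0) (b i0).
have bnd (s : 'cV[R]_d) : F s <= F 0 -> forall i, `|s i 0| <= Q + 1 + k * `|b i0|.
  move=> Fs i.
  have : dot (s + k *: b i0) (s + k *: b i0) <= Q.
    have := mge s i0; move: Fs; rewrite /F dot0l mul0r addr0 => H1 H2.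
    have : dot s s / (2 * k) + dot (b i0) s <= m 0 - a i0 by lra.
    rewrite -(ler_pM2l (_ : 0 < 2 * k)) ?mulr_gt0// mulrDr mulrCA divff ?mulr1.
      by rewrite /Q !dotE (dotC s (b i0)); lra.
    by rewrite mulf_neq0// gt_eqF.
  move=> HQ; have : (s i 0 + k * b i0 i 0) ^+ 2 <= Q.
    apply: le_trans HQ; rewrite /dot (bigD1 i)//= !mxE -expr2 lerDl.
    by apply: sumr_ge0 => j _; rewrite -expr2 sqr_ge0.
  have := mx_norm_entry (b i0) i 0; set e := b i0 i 0; set nb := `|b i0|.
  rewrite !ler_norml => /andP[e1 e2] sq.
  have ke1 : - (k * nb) <= k * e by rewrite -mulrN ler_pM2l.
  have ke2 : k * e <= k * nb by rewrite ler_pM2l.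
  have z1 : s i 0 + k * e <= Q + 1 by have := sqr_ge0 (s i 0 + k * e - 1); nra.
  have z2 : - (Q + 1) <= s i 0 + k * e.
    by have := sqr_ge0 (s i 0 + k * e + 1); nra.
  by apply/andP; split; lra.
have [|u _ umin] := @argmin_rV R d setT (fun u => F u^T) 0
  (Q + 1 + k * `|b i0|) cF closedT I.
  move=> x _ Fx i; have xF : F x^T <= F 0 by move: Fx; rewrite trmx0.
  by have := bnd _ xF i; rewrite mxE.
exists u^T => s; set s0 := u^T.
suff : dot (s - s0) (s - s0) / (2 * k) <= F s - F s0 by rewrite /F; lra.
(* The minimizer s0 is compared with s0 + t (s - s0). The piece active at that point is below m at
   both s and s0; dividing by t leaves the quadratic term with a factor 1 - t, which [ler_contract]
   removes. *)
apply: ler_contract => t /andP[t0 t1].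
have := umin (s0 + t *: (s - s0))^T I; rewrite trmxK -/s0.
have [i mi] := mex (s0 + t *: (s - s0)); have := mge s0 i; have := mge s i.
rewrite /F mi !dotE !(dotC s0 s); move: (dot (b i) s) (dot (b i) s0) (dot s s)
  (dot s s0) (dot s0 s0) => bs bs0 ss ss0 s0s0 H1 H2 H3.
have k20 : 0 < (2 * k)^-1 by rewrite invr_gt0 mulr_gt0.
move: (2 * k)^-1 k20 H3 => c c0 H3.
have H4 : t * (a i + bs) <= t * m s by rewrite ler_pM2l.
have H5 : (1 - t) * (a i + bs0) <= (1 - t) * m s0 by rewrite ler_pM2l// subr_gt0.
rewrite -(ler_pM2l t0); nra.
Qed.

Section QuadraticGrowth.
Context {R : realType} {d : nat} (mu k : R) (h : 'cV[R]_d -> R)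
  (s : 'cV[R]_d -> 'cV[R]_d).
Hypotheses (mu0 : 0 < mu) (k0 : 0 < k)
  (hs : forall x z, h x + dot (s x) (z - x)
     + dot (s x - s z) (s x - s z) / (2 * k) <= h z).
Let f x := h x + mu / 2 * dot x x.

Let k20 : 0 < (2 * k)^-1. Proof. by rewrite invr_gt0 mulr_gt0. Qed.

Let tangent x z : h x + dot (s x) (z - x) <= h z.
Proof.
by have := hs x z; have := mulr_ge0 (dot_ge0 (s x - s z)) (ltW k20); lra.
Qed.

(** [hs] is the cocoercive form of convexity plus k-smoothness, with [s] in the role of the
    gradient. Exchanging x and z in it and using 0 <= |w - k e|^2 recovers the quadratic upper
    model. *)
Let upper x z : h z <= h x + dot (s x) (z - x) + k / 2 * dot (z - x) (z - x).
Proof.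
have := hs z x; rewrite -opprB dotNr; set e := z - x; set w := s z - s x.
have -> : s x = s z - w by rewrite /w opprB addrC subrK.
rewrite dotBl => H; have := dot_ge0 (w - k *: e).
move: H; clearbody e w; rewrite !dotE (dotC e w) => + /(mulr_ge0 (ltW k20)).
set D := dot w e; set E := dot e e; set W := dot w w.
move=> H; rewrite [X in 0 <= X](_ : _ = W / (2 * k) - D + k / 2 * E); first by lra.
by field; rewrite gt_eqF.
Qed.

(** f is squeezed between an affine function and that function plus a quadratic, both exact at x. *)
Lemma grad_quadratic_growth x :
  differentiable f x /\ grad f x = s x + mu *: x.
Proof.
apply: (@differentiable_quad_bound _ _ _ _ _ ((k + mu) / 2)) => v.
have := tangent x (x + v); have := upper x (x + v).
rewrite [x + v - x]addrC addKr /f !dotE (dotC v x) => H1 H2.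
have v0 := dot_ge0 v; rewrite ger0_norm; first by nra.
have : 0 <= mu * dot v v by rewrite mulr_ge0// ltW.
lra.
Qed.

Lemma smooth_strongly_convex_quadratic_growth :
  smooth_strongly_convex mu (k + mu) f.
Proof.
split=> [x|x y|]; first by have [] := grad_quadratic_growth x.
- have [[_ ->] [_ ->]] := (grad_quadratic_growth x, grad_quadratic_growth y).
  rewrite ler_enorm; last by rewrite addr_ge0// ltW.
  (* Adding [hs] in both orders gives cocoercivity |w|^2 <= k <w, e>, hence |w|^2 <= k^2 |e|^2 and
     <w, e> <= k |e|^2; expanding |w + mu e|^2 then yields the constant k + mu. *)
  have := hs x y; have := hs y x; set e := x - y; set w := s x - s y.
  have -> : s x + mu *: x - (s y + mu *: y) = w + mu *: e.
    by rewrite opprD addrACA -scalerBr.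
  rewrite -(opprB x) -(opprB (s x)) -/e -/w !dotNl !dotNr opprK => H1 H2.
  have wE : dot w e = dot (s x) e - dot (s y) e by rewrite dotBl.
  have : dot w w / (2 * k) *+ 2 <= dot w e by rewrite mulr2n; lra.
  have -> : dot w w / (2 * k) *+ 2 = dot w w / k.
    by field; rewrite gt_eqF.
  rewrite ler_pdivrMr// => H3; have := dot_ge0 (w - k *: e).
  move: (dot_ge0 e) H3; clear H1 H2; clearbody e w; rewrite !dotE (dotC e w).
  set D := dot w e; set E := dot e e; set W := dot w w => E0 H3 H4.
  have WE : W <= k ^+ 2 * E by lra.
  have DE : D <= k * E by rewrite -(ler_pM2r k0); lra.
  have : 2 * mu * D <= 2 * mu * (k * E) by rewrite ler_pM2l// mulr_gt0.
  lra.
- apply/convex_functionP => x y t /andP[t0 t1].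
  have fh z : f z - mu / 2 * enorm z ^+ 2 = h z by rewrite enorm_sqr /f addrK.
  rewrite !fh; set p := _ + _.
  have tp : t *: (x - p) + (1 - t) *: (y - p) = 0.
    rewrite !scalerBr addrACA -/p -opprD -scalerDl [t + _]addrC subrK scale1r.
    by rewrite subrr.
  have := tangent p y; have := tangent p x; have := congr1 (dot (s p)) tp.
  rewrite dotDr !dotZr dot0r; move: (dot _ _) (dot _ _) => a b ab H1 H2.
  have := ler_wpM2l t0 H1; have t1' : 0 <= 1 - t by rewrite subr_ge0.
  by have := ler_wpM2l t1' H2; lra.
Qed.

End QuadraticGrowth.

Lemma continuous_bigmax {R : realType} {T : topologicalType} (J : Type)
    (r : seq J) (f : T -> R) (F : J -> T -> R) :
  continuous f -> (forall j, continuous (F j)) ->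
  continuous (fun x => \big[Num.max/f x]_(j <- r) F j x).
Proof.
move=> cf cF; elim: r => [|j r IHr].
  by rewrite (_ : (fun x => _) = f)//; apply/funext => x; rewrite big_nil.
rewrite (_ : (fun x => _) = fun x =>
    Num.max (F j x) (\big[Num.max/f x]_(j <- r) F j x)).
  by move=> x; apply: continuous_max; [exact: cF|exact: IHr].
by apply/funext => x; rewrite big_cons.
Qed.

(* With k = L - mu, the interpolant is h(x) + mu |x|^2 / 2 where h is the convex
   conjugate of s |-> max_i (a_i + b_i . s) + |s|^2 / (2 k), the affine
   pieces being dictated by the data, and grad h (x) is the maximizer [s x]. *)
Theorem smooth_strongly_convex_interpolation {R : realType} d (mu L : R)
    (J : finType) (j0 : J) (y g : J -> 'cV[R]_d) (v : J -> R) :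
    0 < mu -> mu < L ->
    (forall i j, 0 <= gap mu L (y i) (y j) (g i) (g j) (v i) (v j)) ->
  exists2 f, smooth_strongly_convex mu L f &
    forall i, f (y i) = v i /\ grad f (y i) = g i.
Proof.
move=> mu0 muL G; pose k := L - mu; have k0 : 0 < k by rewrite subr_gt0.
pose u i := g i - mu *: y i; pose e i := v i - mu / 2 * dot (y i) (y i).
(* [u] and [e] are the data of h = f - mu |x|^2 / 2. With these coefficients, a_i + b_i . s + |s|^2
   / (2 k) equals <y_i, s> - e_i + |s - u_i|^2 / (2 k), the lower bound that datum i imposes on the
   conjugate of h, which is strongly convex with modulus 1/k. *)
pose a i := dot (u i) (u i) / (2 * k) - e i; pose b i := y i - k^-1 *: u i.
pose m s := \big[Num.max/a j0 + dot (b j0) s]_i (a i + dot (b i) s).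
have mge s i : a i + dot (b i) s <= m s by exact: le_bigmax.
have mex s : exists i, m s = a i + dot (b i) s.
  rewrite /m; elim/big_ind: _ => [|_ _ [i ->] [j ->]|i _]; [by exists j0| |by exists i].
  by have [_|_] := leP (a i + dot (b i) s) (a j + dot (b j) s);
    [exists j|exists i].
have cdot (c : 'cV[R]_d) : continuous (fun w : 'rV[R]_d => dot c w^T).
  apply: continuous_sum => i _; apply: continuous_mul; first exact: continuous_cst.
  rewrite (_ : (fun _ => _) = fun w : 'rV[R]_d => w 0 i).
    exact: coord_continuous.
  by apply/funext => w; rewrite mxE.
have cm : continuous (fun w : 'rV[R]_d => m w^T).
  have cab i : continuous (fun w : 'rV[R]_d => a i + dot (b i) w^T).
    by apply: continuous_add => //; exact: continuous_cst.
  exact: continuous_bigmax.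
have argm x : exists s0, forall s, m s0 + dot s0 s0 / (2 * k) - dot x s0
    + dot (s - s0) (s - s0) / (2 * k) <= m s + dot s s / (2 * k) - dot x s.
  have [|s i|s|s0 s0P] := @max_quad_argmin R d J j0 k a (fun i => b i - x)
    (fun s => m s - dot x s) k0.
  - by apply: continuous_add cm _; exact/continuous_opp.
  - by rewrite dotBl addrA lerB.
  - by have [i ->] := mex s; exists i; rewrite dotBl addrA.
  - by exists s0 => s; have := s0P s; lra.
have [s sP] := choice argm.
pose h x := dot x (s x) - m (s x) - dot (s x) (s x) / (2 * k).
have hs x z : h x + dot (s x) (z - x)
     + dot (s x - s z) (s x - s z) / (2 * k) <= h z.
  by have := sP z (s x); rewrite /h (dotBr z) (dotC _ z) (dotC _ x); lra.
have sy i : s (y i) = u i /\ h (y i) = e i.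
  (* Piece i is the maximal one at u_i: up to the factor k, its excess over piece j there is exactly
     the gap of (j, i). *)
  have mu_i : m (u i) = dot (y i) (u i) - dot (u i) (u i) / (2 * k) - e i.
    have mi : a i + dot (b i) (u i) =
        dot (y i) (u i) - dot (u i) (u i) / (2 * k) - e i.
      by rewrite /a /b; clearbody u k; rewrite dotBl dotZl; field; rewrite gt_eqF.
    apply/eqP; rewrite -mi eq_le mge andbT mi; have [j ->] := mex (u i).
    have := G j i; rewrite (_ : gap _ _ _ _ _ _ _ _ = k *
      (dot (y i) (u i) - dot (u i) (u i) / (2 * k) - e i
       - (a j + dot (b j) (u i)))).
      by rewrite pmulr_rge0// subr_ge0.
    rewrite /gap /a /b /e -/k; have gE l : g l = u l + mu *: y l by rewrite subrK.
    rewrite !gE; have kL : L = k + mu by rewrite subrK.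
    rewrite kL; clearbody u k; rewrite !dotE.
    rewrite ?(dotC (y i) (u _)) ?(dotC (y j) (u _)) ?(dotC (y j) (y i)).
    rewrite ?(dotC (u j) (u i)); field.
    by rewrite gt_eqF.
  (* The growth at the minimizer s(y_i), tested at u_i, meets the lower bound of piece i at s(y_i);
     together they force |u_i - s(y_i)|^2 <= 0. *)
  have H := sP (y i) (u i); have K := mge (s (y i)) i.
  have aE : a i + dot (b i) (s (y i)) + dot (s (y i)) (s (y i)) / (2 * k)
      - dot (y i) (s (y i)) =
      dot (u i - s (y i)) (u i - s (y i)) / (2 * k) - e i.
    rewrite /a /b; clearbody u; rewrite !dotE (dotC (s _) (u i)); field.
    by rewrite gt_eqF.
  have D0 : dot (u i - s (y i)) (u i - s (y i)) / (2 * k) = 0.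
    apply/eqP; rewrite eq_le divr_ge0 ?dot_ge0 ?mulr_ge0 ?(ltW k0)// andbT.
    by move: H; rewrite mu_i; lra.
  have us : u i = s (y i).
    apply/eqP; rewrite -subr_eq0; apply/eqP/dot_eq0; move: D0 => /eqP.
    by rewrite mulf_eq0 invr_eq0 mulf_eq0 (gt_eqF k0) pnatr_eq0 !orbF => /eqP.
  by split=> //; rewrite /h -us mu_i; lra.
exists (fun x => h x + mu / 2 * dot x x) => [|i].
  rewrite -(subrK mu L).
  exact: (smooth_strongly_convex_quadratic_growth mu0 k0 hs).
have [_ ->] := grad_quadratic_growth mu0 k0 hs (y i).
by have [-> ->] := sy i; rewrite /e /u !subrK.
Qed.

(** * Conic duality *)

(** The pairing of A with the Gram matrix Z Z^T. Working with Z makes semidefiniteness automatic and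
    lets the rows of Z be the vectors x and g themselves. *)
Definition gram_form {R : realType} n d (A : 'M[R]_n) (Z : 'M[R]_(n, d)) : R :=
  \tr (Z^T *m A *m Z).

Section GramForm.
Context {R : realType} {n d : nat}.
Implicit Types (A B : 'M[R]_n) (Z : 'M[R]_(n, d)).

Lemma gram_formE A Z : gram_form A Z = \sum_l quad A (col l Z).
Proof.
apply: eq_bigr => l _; rewrite /quad -!mulmxA !mxE; apply: eq_bigr => i _.
by rewrite !mxE; congr (_ * _); apply: eq_bigr => j _; rewrite !mxE.
Qed.

Lemma gram_formD A B Z : gram_form (A + B) Z = gram_form A Z + gram_form B Z.
Proof. by rewrite /gram_form mulmxDr mulmxDl mxtraceD. Qed.

Lemma gram_formZ a A Z : gram_form (a *: A) Z = a * gram_form A Z.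
Proof. by rewrite /gram_form -scalemxAr -scalemxAl mxtraceZ. Qed.

Lemma gram_formN A Z : gram_form (- A) Z = - gram_form A Z.
Proof. by rewrite -scaleN1r gram_formZ mulN1r. Qed.

Lemma gram_form_sum (J : Type) (r : seq J) (P : pred J) (F : J -> 'M[R]_n) Z :
  gram_form (\sum_(j <- r | P j) F j) Z =
  \sum_(j <- r | P j) gram_form (F j) Z.
Proof. by rewrite /gram_form mulmx_sumr mulmx_suml raddf_sum. Qed.

Lemma possemidef_gram_form A Z : possemidef A -> 0 <= gram_form A Z.
Proof. by move=> A0; rewrite gram_formE sumr_ge0. Qed.

End GramForm.

Lemma quadE {R : realType} n (A : 'M[R]_n) (z : 'cV[R]_n) :
  quad A z = \sum_j \sum_i z i 0 * A i j * z j 0.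
Proof.
rewrite /quad mxE; apply: eq_bigr => j _; rewrite mxE mulr_suml.
by apply: eq_bigr => i _; rewrite mxE.
Qed.

Lemma gram_form_entries {R : realType} n d (A : 'M[R]_n) (Z : 'M[R]_(n, d)) :
  gram_form A Z = \sum_l \sum_j \sum_i Z i l * A i j * Z j l.
Proof.
rewrite gram_formE; apply: eq_bigr => l _; rewrite quadE.
by apply: eq_bigr => j _; apply: eq_bigr => i _; rewrite !mxE.
Qed.

Lemma continuous_gram_form {R : realType} {T : topologicalType} n d
    (A : 'M[R]_n) (Z : T -> 'M[R]_(n, d)) :
  (forall i l, continuous (fun u => Z u i l)) ->
  continuous (fun u => gram_form A (Z u)).
Proof.
move=> cZ; rewrite (_ : (fun u => _) = fun u =>
    \sum_l \sum_j \sum_i Z u i l * A i j * Z u j l).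
  do 3!apply: continuous_sum => ? _; apply: continuous_mul => //.
  by apply: continuous_mul => //; exact: continuous_cst.
by apply/funext => u; rewrite gram_form_entries.
Qed.

Lemma continuous_dot {R : realType} {T : topologicalType} d (a : 'cV[R]_d)
    (F : T -> 'cV[R]_d) :
  (forall i, continuous (fun u => F u i 0)) -> continuous (fun u => dot a (F u)).
Proof.
move=> cF; apply: continuous_sum => i _; apply: continuous_mul => //.
exact: continuous_cst.
Qed.

Lemma gram_form_scale {R : realType} n d (A : 'M[R]_n) (Z : 'M[R]_(n, d)) t :
  gram_form A (t *: Z) = t ^+ 2 * gram_form A Z.
Proof.
rewrite !gram_form_entries; do 3![rewrite mulr_sumr; apply: eq_bigr => ? _].
by rewrite !mxE; ring.
Qed.

(** Induction through the Schur complement of the first pivot a. *)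
Lemma possemidef_cholesky {R : realType} n (G : 'M[R]_n) :
  G^T = G -> possemidef G -> exists B : 'M[R]_n, G = B *m B^T.
Proof.
elim: n G => [|n IHn] G Gs Gp; first by exists G; apply/matrixP => -[].
pose a := G 0 0; pose b : 'cV[R]_n := dlsubmx (G : 'M[R]_(1 + n)).
pose D : 'M[R]_n := drsubmx (G : 'M[R]_(1 + n)).
have GE : G = block_mx a%:M b^T b D :> 'M[R]_(1 + n).
  rewrite -[LHS](@submxK _ 1 n 1 n); congr block_mx.
    by rewrite [LHS]mx11_scalar !mxE; congr (G _ _)%:M; apply/val_inj.
  by rewrite trmx_dlsub Gs.
have Ds : D^T = D by rewrite trmx_drsub Gs.
clearbody a b D; have q t (z : 'cV[R]_n) :
    0 <= a * t ^+ 2 + 2 * t * (b^T *m z) 0 0 + quad D z.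
  have := Gp (col_mx (t%:M : 'M[R]_1) z); rewrite /quad GE.
  rewrite (@tr_col_mx _ 1 n) (@mul_row_block _ 1 1 n 1 n) (@mul_row_col _ 1 1 n).
  have -> : z^T *m b = b^T *m z.
    by rewrite -[LHS]trmxK trmx_mul trmxK [RHS]mx11_scalar [in LHS](mx11_scalar (b^T *m z)) tr_scalar_mx.
  rewrite tr_scalar_mx !mul_scalar_mx !mul_mx_scalar mulmxDl -!scalemxAl !mxE.
  by rewrite eqxx mulr1n => H; lra.
have a_ge0 : 0 <= a by have := q 1 0; rewrite /quad !mulmx0 !mxE; lra.
have b0 : a = 0 -> b = 0.
  move=> a0; apply/matrixP => i j; rewrite ord1 mxE; apply/eqP/negPn/negP => bi.
  (* For a = 0 the form is affine in t; this t makes it equal to -1. *)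
  have := q (- (quad D (delta_mx i 0) + 1) / (2 * b i 0)) (delta_mx i 0).
  rewrite a0 -colE !mxE mul0r add0r; set e := quad D _.
  rewrite (_ : 2 * _ * _ = - (e + 1)); first by lra.
  by field.
(* If a = 0 then b = 0 and [a^-1] is 0, so D' = D and no case distinction is needed in the
   definition. *)
pose D' := D - a^-1 *: (b *m b^T).
have D'E z : quad D' z = quad D z - a^-1 * (b^T *m z) 0 0 ^+ 2.
  have E : z^T *m (b *m b^T) *m z = (b^T *m z)^T *m (b^T *m z).
    by rewrite trmx_mul trmxK !mulmxA.
  rewrite /quad /D' mulmxBr mulmxBl -scalemxAr -scalemxAl E.
  move: (b^T *m z) => w; rewrite !mxE; congr (_ - _ * _).
  by rewrite big_ord1 mxE expr2.
have [||C CE] := IHn D'.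
- by rewrite /D' linearB linearZ/= trmx_mul trmxK Ds.
- move=> z; rewrite D'E; have [a0|a0] := eqVneq a 0.
    by have := q 0 z; rewrite a0 b0// trmx0 mul0mx mxE; lra.
  (* This t minimizes the form for fixed z, and the minimum is the Schur complement at z. *)
  have := q (- (b^T *m z) 0 0 / a) z.
  by rewrite (_ : _ + quad _ _ = quad D z - a^-1 * (b^T *m z) 0 0 ^+ 2)//; field.
pose r := Num.sqrt a; pose B : 'M[R]_(1 + n) := block_mx r%:M 0 (r^-1 *: b) C.
have rb : r *: (r^-1 *: b) = b.
  have [a0|a0] := eqVneq a 0; first by rewrite b0// !scaler0.
  rewrite scalerA divff ?scale1r// gt_eqF// sqrtr_gt0 lt_neqAle eq_sym a0//.
have rr : r ^+ 2 = a by rewrite sqr_sqrtr.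
exists B; rewrite GE /B (@tr_block_mx _ 1 n 1 n) (@mulmx_block _ 1 n 1 n 1 n).
rewrite tr_scalar_mx trmx0 !mul_scalar_mx !mul0mx !mulmx0 !addr0 linearZ/=.
have rbT : r *: (r^-1 *: b^T) = b^T.
  by apply/matrixP => i j; rewrite -{2}rb !mxE.
have DE : (r^-1 *: b) *m (r^-1 *: b^T) + D' = D.
  rewrite -scalemxAl -scalemxAr scalerA -expr2 exprVn rr /D'.
  by rewrite addrC subrK.
by rewrite mul_mx_scalar scale_scalar_mx -expr2 rr -CE ?rb rbT DE.
Qed.

Section TraceProduct.
Context {R : realType} {p q : nat}.
Implicit Types X Y Z : 'M[R]_(p, q).

Definition mdot X Y : R := \tr (X^T *m Y).

Lemma mdotC X Y : mdot X Y = mdot Y X.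
Proof. by rewrite /mdot -mxtrace_tr trmx_mul trmxK. Qed.

Lemma mdotDr X Y Z : mdot Z (X + Y) = mdot Z X + mdot Z Y.
Proof. by rewrite /mdot mulmxDr mxtraceD. Qed.

Lemma mdotZr a X Z : mdot Z (a *: X) = a * mdot Z X.
Proof. by rewrite /mdot -scalemxAr mxtraceZ. Qed.

Lemma mdotDl X Y Z : mdot (X + Y) Z = mdot X Z + mdot Y Z.
Proof. by rewrite mdotC mdotDr !(mdotC Z). Qed.

Lemma mdotZl a X Z : mdot (a *: X) Z = a * mdot X Z.
Proof. by rewrite mdotC mdotZr mdotC. Qed.

Lemma mdotE X Y : mdot X Y = \sum_j \sum_i X i j * Y i j.
Proof.
apply: eq_bigr => j _; rewrite mxE; apply: eq_bigr => i _.
by rewrite mxE.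
Qed.

Lemma mdot_entry X i j : X i j ^+ 2 <= mdot X X.
Proof.
have X0 k l : 0 <= X k l * X k l by rewrite -expr2 sqr_ge0.
rewrite mdotE (bigD1 j)//= (bigD1 i)//= expr2 -addrA lerDl addr_ge0//.
  by rewrite sumr_ge0.
by rewrite sumr_ge0// => k _; rewrite sumr_ge0.
Qed.

Lemma mdot_ge0 X : 0 <= mdot X X.
Proof.
by rewrite mdotE; do 2![apply: sumr_ge0 => ? _]; rewrite -expr2 sqr_ge0.
Qed.

Lemma mdot_eq0 X : mdot X X = 0 -> X = 0.
Proof.
move=> X0; apply/matrixP => i j; rewrite mxE; apply/eqP.
by rewrite -sqrf_eq0 eq_le sqr_ge0 andbT -X0 mdot_entry.
Qed.

End TraceProduct.

Lemma gram_form_mdot {R : realType} n d (A : 'M[R]_n) (Z : 'M[R]_(n, d)) :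
  gram_form A Z = mdot (Z *m Z^T) A.
Proof. by rewrite /gram_form mxtrace_mulC mulmxA /mdot trmx_mul trmxK. Qed.

(** Turns minimality along a segment into a first order condition. If p < 0, the witness t = - p /
    (|q| - p) makes p + t q negative. *)
Lemma ler_linear_perturbation {R : realType} (p q : R) :
  (forall t, 0 < t <= 1 -> 0 <= p + t * q) -> 0 <= p.
Proof.
move=> H; rewrite leNgt; apply/negP => p0.
have q0 : 0 < `|q| - p by rewrite subr_gt0 (lt_le_trans p0).
have /H : 0 < - p / (`|q| - p) <= 1.
  by rewrite divr_gt0 ?oppr_gt0//= ler_pdivrMr// mul1r lerDr.
apply/negP; rewrite -ltNge.
apply: (@le_lt_trans _ _ (p + - p / (`|q| - p) * `|q|)).
  by rewrite lerD2l ler_wpM2l ?ler_norm// divr_ge0 ?ltW// oppr_gt0.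
rewrite (_ : _ + _ = - (p ^+ 2) / (`|q| - p)); last by field; rewrite gt_eqF.
by rewrite pmulr_llt0 ?invr_gt0// oppr_lt0 exprn_even_gt0//= lt_eqF.
Qed.

Section Possemidef.
Context {R : realType} {n : nat}.
Implicit Types (A B : 'M[R]_n) (z : 'cV[R]_n).

Lemma quad_gram_form A z : quad A z = gram_form A z.
Proof. by rewrite gram_formE big_ord1; congr quad; apply/matrixP => i j; rewrite ord1 mxE. Qed.

Lemma possemidefD A B : possemidef A -> possemidef B -> possemidef (A + B).
Proof.
by move=> Ap Bp z; rewrite quad_gram_form gram_formD addr_ge0// -quad_gram_form.
Qed.

Lemma possemidefZ a A : 0 <= a -> possemidef A -> possemidef (a *: A).
Proof.
by move=> a0 Ap z; rewrite quad_gram_form gram_formZ mulr_ge0// -quad_gram_form.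
Qed.

Lemma quad_tr A z : quad A^T z = quad A z.
Proof.
rewrite /quad -[in RHS](trmxK (z^T *m A *m z)) [RHS]mxE.
by rewrite !trmx_mul trmxK mulmxA.
Qed.

Lemma possemidef_rank1 z : possemidef (z *m z^T).
Proof.
move=> w; have E : w^T *m (z *m z^T) *m w = (z^T *m w)^T *m (z^T *m w).
  by rewrite trmx_mul trmxK !mulmxA.
by rewrite /quad E; move: (z^T *m w) => c; rewrite !mxE big_ord1 mxE -expr2 sqr_ge0.
Qed.

End Possemidef.

Lemma closed_forall {T : topologicalType} (J : Type) (P : J -> set T) :
  (forall j, closed (P j)) -> closed [set x | forall j, P j x].
Proof.
move=> cP; rewrite (_ : [set x | _] = \bigcap_(j in setT) P j).
  exact: closed_bigI.
by apply/seteqP; split => x Px j *; exact: Px.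
Qed.

(* Strong duality is obtained without a separation theorem: the least-squares
   residual [(D, E)] of [(A, a)] over the dual cone is itself, by the first
   order optimality conditions, a point of the primal cone, which forces it to
   vanish.  Slater's condition only serves to make the minimum attained. *)
Section ConicDuality.
Context {R : realType} {n k m : nat} (A : 'M[R]_n) (a : 'cV[R]_k)
  (M : 'I_m -> 'M[R]_n) (v : 'I_m -> 'cV[R]_k).
Let phi r d (Z : 'M[R]_(n, d)) F := gram_form (M r) Z + dot (v r) F.

Hypothesis primal : forall (Z : 'M[R]_n) F, (forall r, 0 <= phi r Z F) ->
  0 <= gram_form A Z + dot a F.
Hypothesis slater : exists d (Z : 'M[R]_(n, d)) F, forall r, 0 < phi r Z F.

Let lamM (l : 'I_m -> R) := \sum_r l r *: M r.
Let lamv (l : 'I_m -> R) := \sum_r l r *: v r.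
Let dual (l : 'I_m -> R) S := (forall r, 0 <= l r) /\ possemidef (S - lamM l).
Let res (l : 'I_m -> R) (S : 'M[R]_n) :=
  mdot (S - A) (S - A) + dot (lamv l - a) (lamv l - a).

Let sqr_le (x c : R) : x ^+ 2 <= c -> `|x| <= c + 1.
Proof.
move=> xc; rewrite ler_norml; apply/andP; split.
  by have := sqr_ge0 (x + 1); nra.
by have := sqr_ge0 (x - 1); nra.
Qed.

(** A bounded residual bounds S and [lamv l]. Pairing them with the Slater point bounds the sum of
    l_r phi_r, whose terms are nonnegative with phi_r > 0, so each l_r is bounded too. *)
Let dual_bound c : 0 <= c -> exists C, forall l S, dual l S -> res l S <= c ->
  (forall r, l r <= C) /\ (forall i j, `|S i j| <= C).
Proof.
move=> c0; have [d [Z [F ZF]]] := slater.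
pose CS := `|A| + c + 1; pose Cv := `|a| + c + 1.
pose C1 := \sum_j \sum_i `|(Z *m Z^T) i j| * CS + \sum_i `|F i 0| * Cv.
exists (CS + \sum_r C1 / phi r Z F) => l S [l0 Sp] lS.
have bS i j : `|S i j| <= CS.
  have /sqr_le : (S - A) i j ^+ 2 <= c.
    apply: le_trans (mdot_entry _ i j) _; apply: le_trans lS.
    by rewrite lerDl dot_ge0.
  rewrite !mxE => H; rewrite -(subrK (A i j) (S i j)).
  apply: le_trans (ler_normD _ _) _; rewrite /CS addrC -addrA lerD//.
  exact: mx_norm_entry.
have bv i : `|lamv l i 0| <= Cv.
  have /sqr_le : (lamv l - a) i 0 ^+ 2 <= c.
    apply: le_trans lS; apply: ler_wpDl; first exact: mdot_ge0.
    rewrite /dot (bigD1 i)//= expr2 lerDl; apply: sumr_ge0 => j _.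
    by rewrite -expr2 sqr_ge0.
  rewrite !mxE => H; rewrite -(subrK (a i 0) (lamv l i 0)).
  apply: le_trans (ler_normD _ _) _; rewrite /Cv addrC -addrA lerD//.
  exact: mx_norm_entry.
have C10 : 0 <= C1.
  apply: addr_ge0; repeat (apply: sumr_ge0 => ? _);
    by rewrite mulr_ge0// addr_ge0// addr_ge0.
have lphi : \sum_r l r * phi r Z F <= C1.
  have := possemidef_gram_form Z Sp.
  rewrite gram_formD gram_formN subr_ge0 => H.
  apply: (@le_trans _ _ (gram_form S Z + dot (lamv l) F)).
    rewrite (_ : \sum_r _ = gram_form (lamM l) Z + dot (lamv l) F) ?lerD2r//.
    rewrite gram_form_sum dot_suml -big_split; apply: eq_bigr => r _.
    by rewrite gram_formZ dotZl mulrDr.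
  have le_abs (x y b : R) : `|y| <= b -> x * y <= `|x| * b.
    move=> yb; apply: le_trans (ler_norm _) _; rewrite normrM.
    by rewrite ler_wpM2l.
  rewrite gram_form_mdot mdotE dotC; apply: lerD.
    by do 2!apply: ler_sum => ? _; exact: le_abs.
  by apply: ler_sum => ? _; exact: le_abs.
split=> [r|i j].
  apply: (@le_trans _ _ (C1 / phi r Z F)).
    rewrite ler_pdivlMr//; apply: le_trans lphi; rewrite (bigD1 r)//= lerDl.
    by apply: sumr_ge0 => s _; rewrite mulr_ge0 ?l0// ltW.
  rewrite (bigD1 r)//= addrCA lerDl addr_ge0 ?addr_ge0// sumr_ge0// => s _.
  by rewrite divr_ge0// ltW.
apply: le_trans (bS i j) _; rewrite lerDl sumr_ge0// => r _.
by rewrite divr_ge0// ltW.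
Qed.

Let dual_min : exists l S, dual l S /\
  forall l' S', dual l' S' -> res l S <= res l' S'.
Proof.
pose l (u : 'rV[R]_(m + n * n)) r := u 0 (lshift (n * n) r).
pose S (u : 'rV[R]_(m + n * n)) : 'M[R]_n :=
  \matrix_(i, j) u 0 (rshift m (mxvec_index i j)).
pose flat (l : 'I_m -> R) (S : 'M[R]_n) := row_mx (\row_r l r) (mxvec S).
have lflat l' S' : l (flat l' S') = l'.
  by apply/funext => r; rewrite /l row_mxEl mxE.
have Sflat l' S' : S (flat l' S') = S'.
  by apply/matrixP => i j; rewrite mxE row_mxEr mxvecE.
have cl r : continuous (l^~ r) by exact: coord_continuous.
have cS i j : continuous (fun u => S u i j).
  rewrite (_ : (fun u => _) = fun u : 'rV[R]_(m + n * n) =>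
    u 0 (rshift m (mxvec_index i j))); first exact: coord_continuous.
  by apply/funext => u; rewrite mxE.
have cres : continuous (fun u => res (l u) (S u)).
  have cD i j : continuous (fun u => (S u - A) i j).
    rewrite (_ : (fun u => _) = fun u => S u i j + - A i j).
      by apply: continuous_add (cS i j) _; exact: continuous_cst.
    by apply/funext => u; rewrite !mxE.
  have cE i : continuous (fun u => (lamv (l u) - a) i 0).
    rewrite (_ : (fun u => _) = fun u => \sum_r l u r * v r i 0 + - a i 0).
      apply: continuous_add; last exact: continuous_cst.
      by apply: continuous_sum => r _; apply: continuous_mul (cl r) _;
        exact: continuous_cst.
    apply/funext => u; rewrite !mxE summxE; congr (_ + _).
    by apply: eq_bigr => r _; rewrite mxE.
  apply: continuous_add.
    rewrite (_ : (fun u => _) = fun u => \sum_j \sum_i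
      (S u - A) i j * (S u - A) i j).
      by do 2!apply: continuous_sum => ? _; exact: continuous_mul.
    by apply/funext => u; rewrite mdotE.
  by apply: continuous_sum => i _; exact: continuous_mul.
have cdual : closed [set u | dual (l u) (S u)].
  apply: closedI.
    by apply: closed_forall => r; exact: closed_superlevel.
  apply: closed_forall => z; apply: closed_superlevel.
  rewrite (_ : (fun u => _) = fun u => \sum_j \sum_i (z *m z^T) i j * S u i j
      + - \sum_r l u r * gram_form (M r) z).
    apply: continuous_add.
      by do 2!apply: continuous_sum => ? _; apply: continuous_mul => //;
        exact: continuous_cst.
    apply: continuous_opp; apply: continuous_sum => r _.
    by apply: continuous_mul => //; exact: continuous_cst.
  apply/funext => u; rewrite quad_gram_form gram_formD gram_formN gram_form_sum.
  rewrite -mdotE -gram_form_mdot; congr (_ - _); apply: eq_bigr => r _.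
  by rewrite gram_formZ.
have [|C bC] := @dual_bound (res (fun=> 0) 0).
  by rewrite addr_ge0 ?mdot_ge0 ?dot_ge0.
have d0 : dual (l (flat (fun=> 0) 0)) (S (flat (fun=> 0) 0)).
  rewrite lflat Sflat; split=> // z; rewrite /lamM big1 => [|r _].
    by rewrite subrr /quad mulmx0 mul0mx mxE.
  by rewrite scale0r.
have [|u du umin] := argmin_rV (C := C) cres cdual d0.
  rewrite lflat Sflat => u du ru i; have [lC SC] := bC _ _ du ru.
  case: (split_ordP i) => r ->.
    by have [l0 _] := du; have := lC r; rewrite ger0_norm// l0.
  by case/mxvec_indexP: r => i' j'; have := SC i' j'; rewrite mxE.
exists (l u), (S u); split=> // l' S' d'.
by have := umin (flat l' S'); rewrite /= lflat Sflat; exact.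
Qed.

Let lamMD l l' t :
  lamM (fun r => l r + t * l' r) = lamM l + t *: lamM l'.
Proof.
by rewrite scaler_sumr -big_split; apply: eq_bigr => r _; rewrite scalerDl scalerA.
Qed.

Let lamvD l l' t :
  lamv (fun r => l r + t * l' r) = lamv l + t *: lamv l'.
Proof.
by rewrite scaler_sumr -big_split; apply: eq_bigr => r _; rewrite scalerDl scalerA.
Qed.

Lemma conic_duality : exists l : 'I_m -> R,
  [/\ forall r, 0 <= l r, possemidef (A - \sum_r l r *: M r)
    & a = \sum_r l r *: v r].
Proof.
have [l [S [[l0 Sp] lS]]] := dual_min; exists l.
pose D := S - A; pose E := lamv l - a.
(* Variational inequality at the minimizer: the derivative of [res] is nonnegative along every
   direction (S', l') that stays in the dual cone. *)
have opt l' S' : (forall t : R, 0 < t <= 1 ->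
    (forall r, 0 <= l r + t * l' r) /\
    possemidef (S - lamM l + t *: (S' - lamM l'))) ->
    0 <= mdot D S' + dot E (lamv l').
  move=> H; apply: (@ler_linear_perturbation _ _
    ((mdot S' S' + dot (lamv l') (lamv l')) / 2)) => t t01.
  have [H1 H2] := H t t01; have t0 : 0 < t by case/andP: t01.
  have /lS : dual (fun r => l r + t * l' r) (S + t *: S').
    by split=> //; rewrite lamMD opprD addrACA -scalerBr.
  rewrite /res lamvD [S + _ - A]addrAC [_ + _ - a]addrAC -/D -/E.
  clearbody D E; rewrite !(dotE, mdotDl, mdotDr, mdotZl, mdotZr) (dotC _ E) (mdotC _ D) => K.
  by rewrite -(pmulr_rge0 _ t0); lra.
have SE : S = A + D by rewrite addrC subrK.
have vE : lamv l = a + E by rewrite addrC subrK.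
clearbody D E.
have lamM0 : lamM (fun=> 0) = 0.
  by rewrite /lamM big1// => r _; rewrite scale0r.
have lamv0 : lamv (fun=> 0) = 0.
  by rewrite /lamv big1// => r _; rewrite scale0r.
have Dp X : possemidef X -> 0 <= mdot D X.
  move=> Xp; have := opt (fun=> 0) X; rewrite lamv0 dot0r addr0; apply=> t.
  move=> /andP[t0 _]; split=> [r|]; first by rewrite mulr0 addr0.
  by rewrite lamM0 subr0; apply: possemidefD => //; exact/possemidefZ/Xp/ltW.
(* [possemidef] does not include symmetry, so D^T - D, whose quadratic form vanishes, is an
   admissible direction; its pairing with D is - |D - D^T|^2 / 2. *)
have Ds : D^T = D.
  have : 0 <= mdot D (D^T - D).
    apply: Dp => z; rewrite quad_gram_form gram_formD gram_formN.
    by rewrite -!quad_gram_form quad_tr subrr.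
  rewrite mdotDr -scaleN1r mdotZr => H; apply/eqP; rewrite -subr_eq0; apply/eqP.
  apply: mdot_eq0; apply/eqP; rewrite eq_le mdot_ge0 andbT -scaleN1r.
  rewrite !(mdotDl, mdotDr, mdotZl, mdotZr) (mdotC _ D).
  have -> : mdot D^T D^T = mdot D D.
    by rewrite /mdot trmxK mxtrace_mulC.
  lra.
(* Rank one directions show that D is semidefinite. A factorization D = Z Z^T makes (Z, E) a
   candidate for [primal], and the directions (M r, e_r) give its feasibility. *)
have [|Z DZ] := possemidef_cholesky Ds.
  move=> z; have := Dp _ (possemidef_rank1 z).
  by rewrite mdotC -gram_form_mdot -quad_gram_form.
have ZE r : 0 <= phi r Z E.
  rewrite /phi gram_form_mdot -DZ dotC.
  have lM : lamM (fun s => (s == r)%:R) = M r.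
    rewrite /lamM (bigD1 r)//= eqxx scale1r big1 ?addr0// => s /negPf ->.
    by rewrite scale0r.
  have lv : lamv (fun s => (s == r)%:R) = v r.
    rewrite /lamv (bigD1 r)//= eqxx scale1r big1 ?addr0// => s /negPf ->.
    by rewrite scale0r.
  have := opt (fun s => (s == r)%:R) (M r); rewrite lv; apply=> t /andP[t0 _].
  split=> [s|]; first by rewrite addr_ge0 ?l0// mulr_ge0// ltW.
  by rewrite lM subrr scaler0 addr0.
have := primal ZE; rewrite gram_form_mdot -DZ => H.
(* Shrinking (S, l) towards 0 stays in the dual cone, so <D, A> + <E, a> + |D|^2 + |E|^2 <= 0, while
   [H] says that the first two terms have a nonnegative sum. *)
have {opt} : 0 <= mdot D (- S) + dot E (lamv (fun r => - l r)).
  apply: opt => t /andP[t0 t1]; split=> [r|].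
    by have := l0 r; nra.
  have -> : lamM (fun r => - l r) = - lamM l.
    by rewrite /lamM -sumrN; apply: eq_bigr => r _; rewrite scaleNr.
  rewrite -opprD scalerN -{1}[S - _]scale1r -scalerBl.
  by apply: possemidefZ => //; rewrite subr_ge0.
have -> : lamv (fun r => - l r) = - lamv l.
  by rewrite /lamv -sumrN; apply: eq_bigr => r _; rewrite scaleNr.
rewrite SE vE -scaleN1r mdotZr mdotDr dotNr dotDr (dotC E a) => K.
have DD := mdot_ge0 D; have EE := dot_ge0 E.
have D0 : D = 0 by apply: mdot_eq0; lra.
have E0 : E = 0 by apply: dot_eq0; lra.
by split=> //; [move: Sp; rewrite SE D0 addr0|move: vE; rewrite E0 addr0].
Qed.

End ConicDuality.

(** * The bases of the semidefinite program *)

Section Iteration.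
Context {R : realType} {N : nat} (m : method R N) {V : lmodType R} (G : V -> V).

(** V and G are abstract because this serves both for the gradient on R^d and, in Slater's
    condition, for multiplication by 'X on polynomials. *)
Lemma iteration_exists (x0 : nat -> V) : exists x : nat -> V,
  (forall n, (n <= N)%N -> x n = x0 n) /\
  forall k, x (N + k).+1 = \sum_(j < N.+1) beta m j *: x (N + k - j)%N
    - alpha m *: G (yseq m x k).
Proof.
pose step k x n := if (n <= N + k)%N then x n else
  \sum_(j < N.+1) beta m j *: x (N + k - j)%N - alpha m *: G (yseq m x k).
pose fix upto k := if k is k'.+1 then step k' (upto k') else x0.
have uptoE k l n : (n <= N + k)%N -> (k <= l)%N -> upto l n = upto k n.
  move=> nk; elim: l => [|l IHl]; first by rewrite leqn0 => /eqP ->.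
  rewrite leq_eqVlt => /orP[/eqP ->//|]; rewrite ltnS => kl /=.
  by rewrite /step (leq_trans nk) ?leq_add2l// IHl.
pose x n := upto n n.
have xE k n : (n <= N + k)%N -> x n = upto k n.
  move=> nk; have [kn|/ltnW nk'] := leqP k n; first exact: uptoE.
  by rewrite [RHS](@uptoE n)// leq_addl.
exists x; split=> [n nN|k]; first by rewrite (xE 0%N) ?addn0.
rewrite (xE k.+1) ?addnS//= /step ltnn; congr (_ - _ *: G _).
  by apply: eq_bigr => j _; rewrite (xE k)// leq_subr.
by apply: eq_bigr => j _; rewrite (xE k)// leq_subr.
Qed.

End Iteration.

Section Unroll.
Context {R : realType} {N : nat} (m : method R N) (K : nat) {d : nat}
  (x g : nat -> 'cV[R]_d).

(** The N + 1 initial iterates followed by g_0, ..., g_K: the barred row vectors are the coordinates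
    of the iterates, points and gradients with respect to these rows. *)
Definition basis_values : 'M[R]_(N + K + 2, d) :=
  \matrix_(i, l) if (i <= N)%N then x i l 0 else g (i - N.+1)%N l 0.

Lemma unit_row_mul n i (Z : 'M[R]_(n, d)) (ni : (i < n)%N) :
  (unit_row R n i *m Z)^T = (row (Ordinal ni) Z)^T.
Proof.
congr trmx; apply/rowP => l; rewrite !mxE (bigD1 (Ordinal ni))//= !mxE eqxx mul1r.
rewrite big1 ?addr0// => j ji; rewrite !mxE [(_ == _ :> nat)](_ : _ = false) ?mul0r//.
by apply/negP => /eqP ji'; case/eqP: ji; apply/val_inj.
Qed.

Lemma gbar_basis_values k : (k <= K)%N ->
  (gbar R N K k *m basis_values)^T = g k.
Proof.
move=> kK; have lt : (N + k + 1 < N + K + 2)%N.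
  by lia.
rewrite (unit_row_mul _ lt); apply/colP => l; rewrite !mxE /=.
by rewrite addn1 ltnNge leq_addr/= subSS addKn.
Qed.

Hypothesis xg : forall k, (k <= K)%N -> x (N + k).+1 =
  \sum_(j < N.+1) beta m j *: x (N + k - j)%N - alpha m *: g k.

Lemma xbar_basis_values n : (n <= (N + K).+1)%N ->
  (xbar m K n *m basis_values)^T = x n.
Proof.
elim/ltn_ind: n => n IH nNK; have [nN|] := leqP n N.
  rewrite xbar_init//; have lt : (n < N + K + 2)%N by rewrite addn2 ltnS.
  rewrite (unit_row_mul _ lt); apply/colP => l; rewrite !mxE /=.
  by rewrite nN.
case: n => // n in IH nNK *; rewrite ltnS => Nn; pose k := (n - N)%N.
have nE : n = (N + k)%N by rewrite subnKC.
have kK : (k <= K)%N by move: nNK; rewrite nE ltnS leq_add2l.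
rewrite nE xbar_step xg// mulmxBl mulmx_suml linearB/= linear_sum/=.
congr (_ - _).
  apply: eq_bigr => j _; rewrite -scalemxAl linearZ/= IH//.
    by rewrite ltnS -nE leq_subr.
  by rewrite (leq_trans (leq_subr _ _))// leqW// leq_add2l.
by rewrite -scalemxAl linearZ/= gbar_basis_values.
Qed.

Lemma ybar_basis_values k : (k <= K.+1)%N ->
  (yseq m (xbar m K) k *m basis_values)^T = yseq m x k.
Proof.
move=> kK; rewrite mulmx_suml linear_sum/=; apply: eq_bigr => j _.
rewrite -scalemxAl linearZ/= xbar_basis_values//.
by rewrite (leq_trans (leq_subr _ _))// -addnS leq_add2l.
Qed.

End Unroll.

Lemma fbar_idx_mul {R : realType} K (i : idx K) (F : 'cV[R]_K.+1) :
  (fbar_idx R i *m F) 0 0 = if i is Some k then F k 0 else 0.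
Proof.
case: i => [k|] /=; last by rewrite mul0mx mxE.
have /matrixP/(_ 0 0) := unit_row_mul F (ltn_ord k); rewrite !mxE => ->.
by congr (F _ _); apply/val_inj.
Qed.

Section Gap.
Context {R : realType} {N : nat} (m : method R N) (mu L : R) {K d : nat}.

(** A polynomial identity in the pairwise dot products of y_i, y_j, g_i, g_j. The star index needs
    no separate case, its rows being zero. *)
Lemma Mij_gap (i j : idx K) (Z : 'M[R]_(N + K + 2, d)) (F : 'cV[R]_K.+1) :
  gram_form (Mij m mu L i j) Z + dot (mij mu L i j) F =
  gap mu L (ybar_idx m i *m Z)^T (ybar_idx m j *m Z)^T
    (gbar_idx R N i *m Z)^T (gbar_idx R N j *m Z)^T
    ((fbar_idx R i *m F) 0 0) ((fbar_idx R j *m F) 0 0).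
Proof.
rewrite /gap /mij dotZl.
have -> : dot (fbar_idx R i - fbar_idx R j)^T F =
    (fbar_idx R i *m F) 0 0 - (fbar_idx R j *m F) 0 0.
  rewrite !mxE -sumrB; apply: eq_bigr => l _.
  by rewrite !mxE mulrBl.
rewrite addrC -[RHS]addrA; congr (_ + _); rewrite gram_formZ.
set B : 'M[R]_(4, _) := \matrix_(r < 4) _.
have -> : gram_form (B^T *m interp_mx mu L *m B) Z =
    gram_form (interp_mx mu L) (B *m Z).
  by rewrite /gram_form trmx_mul !mulmxA.
have rowB r : (row r (B *m Z))^T = (nth 0 [:: ybar_idx m i; ybar_idx m j;
    gbar_idx R N i; gbar_idx R N j] r *m Z)^T.
  by rewrite row_mul rowK.
have BB r s : (B *m Z *m (B *m Z)^T) r s =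
    dot (row r (B *m Z))^T (row s (B *m Z))^T.
  by rewrite mxE; apply: eq_bigr => l _; rewrite !mxE.
rewrite gram_form_mdot mdotE.
under eq_bigr do under eq_bigr do rewrite BB !rowB mxE.
rewrite !big_ord_recl !big_ord0 /=.
move: (ybar_idx m i *m Z)^T (ybar_idx m j *m Z)^T => yi yj.
move: (gbar_idx R N i *m Z)^T (gbar_idx R N j *m Z)^T => gi gj.
rewrite !dotE (dotC yj yi) !(dotC _ yi) !(dotC _ yj) (dotC gj gi).
by field.
Qed.

End Gap.

(** * Slater's condition *)

Lemma gap_quadratic {R : realType} d (mu L c : R) (x y : 'cV[R]_d) :
  gap mu L x y (c *: x) (c *: y) (c / 2 * dot x x) (c / 2 * dot y y) =
  (L - c) * (c - mu) / 2 * dot (x - y) (x - y).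
Proof. by rewrite /gap !dotE (dotC y x); field. Qed.

(** A nonzero p has fewer than [size p] roots, so one of [size p] equally spaced interior points is
    not a root. *)
Lemma exists_nonroot_between {R : realType} (p : {poly R}) (a b : R) :
  p != 0 -> a < b -> exists2 c, a < c < b & ~~ root p c.
Proof.
move=> p0 ab; pose t (i : nat) := a + (b - a) * (i.+1%:R / (size p).+1%:R).
pose s := [seq t i | i <- iota 0 (size p)].
have t_inj : injective t.
  move=> i j /addrI /mulfI; rewrite subr_eq0 gt_eqF// => /(_ isT).
  move=> /(mulIf _) H; have {H}/eqP : i.+1%:R = j.+1%:R :> R.
    by apply: H; rewrite invr_eq0 pnatr_eq0.
  by rewrite eqr_nat eqSS => /eqP.
have /allPn[_ /mapP[i ip ->] ri] : ~~ all (root p) s.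
  apply/negP => /(max_poly_roots p0); rewrite map_inj_uniq ?iota_uniq//.
  by move=> /(_ isT); rewrite size_map size_iota ltnn.
exists (t i) => //; move: ip; rewrite mem_iota add0n => /andP[_ ip].
have q0 : 0 < i.+1%:R / (size p).+1%:R :> R by rewrite divr_gt0.
have q1 : i.+1%:R / (size p).+1%:R < 1 :> R.
  by rewrite ltr_pdivrMr// mul1r ltr_nat ltnS.
have : 0 < b - a by rewrite subr_gt0.
by rewrite /t; move: (_ / _) q0 q1 => q q0 q1 ba; apply/andP; split; nra.
Qed.

Section Slater.
Context {R : realType} {N : nat} (m : method R N) (mu L : R).
Hypotheses (muL : mu < L) (alpha0 : alpha m != 0) (gamma0 : gamma m ord0 != 0).

(* On f = c|x|^2/2 the iterates are polynomials in c, and y_k has degree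
   exactly k in c; hence y_0, ..., y_K and 0 are distinct for generic c. *)
Lemma iterates_poly : exists x : nat -> {poly R},
  (forall k, x (N + k).+1 = \sum_(j < N.+1) beta m j *: x (N + k - j)%N
    - alpha m *: (yseq m x k * 'X)) /\
  (forall k, size (yseq m x k) = k.+1).
Proof.
(* Initial conditions x_0 = 1 and x_n = 0 for n < 0, with gradient c y written as multiplication by
   'X. *)
have [x [x0 xS]] := iteration_exists m (fun p : {poly R} => p * 'X)
  (fun n => (n == N)%:R).
exists x; split=> //.
have small k n (c : 'I_n -> R) (J : 'I_n -> nat) :
    (forall j, (size (x (J j)) <= k)%N) ->
    (size (\sum_j c j *: x (J j))%R <= k)%N.
  move=> H; apply: (leq_trans (size_sum _ _ _)); apply/bigmax_leqP => j _.
  exact: leq_trans (size_scale_leq _ _) (H j).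
have sy k : (forall n, (n < N + k)%N -> (size (x n) <= n.+1 - N)%N) ->
    size (x (N + k)%N) = k.+1 -> size (yseq m x k) = k.+1.
  move=> xk kE; rewrite /yseq big_ord_recl subn0 size_polyDl size_scale//.
  rewrite kE ltnS; apply: small => j; apply: leq_trans (xk _ _) _; rewrite lift0.
    by have := ltn_ord j; lia.
  by have := ltn_ord j; lia.
suff : forall k, (forall n, (n < N + k)%N -> (size (x n) <= n.+1 - N)%N) /\
    size (x (N + k)%N) = k.+1.
  by move=> H k; have [] := H k; exact: sy.
elim=> [|k [IHlt IHk]].
  rewrite addn0; split=> [n nN|]; rewrite x0 ?eqxx ?size_poly1 ?(ltnW nN)//.
  by rewrite ltn_eqF// size_poly0.
split=> [n|].
  rewrite addnS ltnS leq_eqVlt => /orP[/eqP ->|]; last exact: IHlt.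
  by rewrite IHk; lia.
(* The degree goes up by exactly one: [alpha m *: (y_k * 'X)] has degree k + 1 and the beta part at
   most k. *)
rewrite addnS xS addrC size_polyDl size_polyN size_scale//.
  by rewrite size_mulX ?sy// -size_poly_gt0 sy.
rewrite size_mulX ?sy// -?size_poly_gt0 ?sy// ltnS.
apply: small => j; case: (posnP j) => [->|j0]; first by rewrite subn0 IHk.
by apply: leq_trans (IHlt _ _) _; have := ltn_ord j; lia.
Qed.

Lemma slater_point K : exists (Z : 'M[R]_(N + K + 2, 1)) F,
  forall i j : idx K, i != j ->
    0 < gram_form (Mij m mu L i j) Z + dot (mij mu L i j) F.
Proof.
have [x [xS sy]] := iterates_poly.
pose y (i : idx K) := if i is Some k then yseq m x k else 0.
have y_inj i j : i != j -> y i - y j != 0.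
  rewrite subr_eq0; apply: contraNneq => /(congr1 (fun p : {poly R} => size p)).
  by case: i j => [i|] [j|]//=; rewrite ?size_poly0 ?sy// => -[/val_inj ->].
(* At a non-root c the points y_k and 0 are pairwise distinct, and mu < c < L makes the factor in
   [gap_quadratic] positive. Diagonal pairs are left out, their gap being zero. *)
pose p := \prod_(i : idx K) \prod_(j | i != j) (y i - y j).
have [|c /andP[muc cL] pc] := @exists_nonroot_between _ p mu L _ muL.
  by apply/prodf_neq0 => i _; apply/prodf_neq0 => j; exact: y_inj.
have y_c i j : i != j -> (y i).[c] != (y j).[c].
  move=> ij; apply: contraNneq pc => yij; rewrite /root /p (bigD1 i)//=.
  by rewrite hornerM (bigD1 j)//= hornerM hornerD hornerN yij subrr !mul0r.
pose xc n : 'cV[R]_1 := (x n).[c]%:M.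
have yxc k : yseq m xc k = (yseq m x k).[c]%:M.
  rewrite /yseq horner_sum raddf_sum; apply: eq_bigr => j _.
  by rewrite hornerZ scale_scalar_mx.
exists (basis_values K xc (fun k => c *: yseq m xc k)).
exists (\col_k (c / 2 * dot (yseq m xc k) (yseq m xc k))) => i j ij.
have xg k : (k <= K)%N -> xc (N + k).+1 =
    \sum_(j < N.+1) beta m j *: xc (N + k - j)%N
    - alpha m *: (c *: yseq m xc k).
  move=> _; rewrite yxc /xc xS hornerD hornerN horner_sum hornerZ hornerMX.
  rewrite [_ * c]mulrC.
  rewrite !scale_scalar_mx raddfB raddf_sum; congr (_ - _).
  by apply: eq_bigr => l _; rewrite hornerZ scale_scalar_mx.
pose yc i : 'cV[R]_1 := (y i).[c]%:M.
have yE i' : (ybar_idx m i' *m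
    basis_values K xc (fun k => c *: yseq m xc k))^T = yc i'.
  case: i' => [l|]; last by rewrite mul0mx trmx0 /yc /= horner0 raddf0.
  by rewrite (ybar_basis_values xg) ?yxc// leqW// -ltnS.
have gE i' : (gbar_idx R N i' *m
    basis_values K xc (fun k => c *: yseq m xc k))^T = c *: yc i'.
  case: i' => [l|]; last by rewrite mul0mx trmx0 /yc /= horner0 raddf0 scaler0.
  by rewrite gbar_basis_values ?yxc// -ltnS.
have fE i' : (fbar_idx R i' *m
    (\col_k (c / 2 * dot (yseq m xc k) (yseq m xc k)))) 0 0 =
    c / 2 * dot (yc i') (yc i').
  rewrite fbar_idx_mul; case: i' => [l|]; first by rewrite mxE yxc.
  by rewrite /yc /= horner0 raddf0 dot0l mulr0.
rewrite Mij_gap !yE !gE !fE gap_quadratic.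
apply: mulr_gt0; first by rewrite divr_gt0// mulr_gt0// subr_gt0.
rewrite lt_neqAle dot_ge0 andbT eq_sym; apply: contraNneq (y_c _ _ ij).
move=> /dot_eq0/matrixP/(_ 0 0); rewrite !mxE eqxx => /eqP.
by rewrite subr_eq0.
Qed.

End Slater.

(** * Runs of the method *)

Lemma sum_mxtens {R : realType} n d (F : 'I_(n * d) -> R) :
  \sum_r F r = \sum_i \sum_l F (mxtens_index (i, l)).
Proof.
rewrite (reindex (@mxtens_index n d)) /=; last first.
  by exists (@mxtens_unindex n d) => ? _; rewrite (mxtens_indexK, mxtens_unindexK).
by rewrite pair_bigA; apply: eq_bigr => -[].
Qed.

Lemma quad_tens1 {R : realType} n d (P : 'M[R]_n) (W : 'M[R]_(n, d)) :
  quad (P *t (1%:M : 'M[R]_d)) (stack (fun i => (row i W)^T)) = gram_form P W.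
Proof.
rewrite quadE gram_formE sum_mxtens exchange_big; apply: eq_bigr => l _.
rewrite quadE; apply: eq_bigr => j _; rewrite sum_mxtens; apply: eq_bigr => i _.
rewrite (bigD1 l)//= big1 ?addr0 => [|k kl].
  by rewrite tensmxE !mxE !mxtens_indexK eqxx mulr1.
by rewrite tensmxE !mxE (negPf kl) !mulr0 mul0r.
Qed.

Lemma stackE {R : realType} n d (u : 'I_n -> 'cV[R]_d) i l :
  stack u (mxtens_index (i, l)) 0 = u i l 0.
Proof. by rewrite mxE mxtens_indexK. Qed.

Lemma castmx_stack {R : realType} n1 n2 d (u : 'I_n1 -> 'cV[R]_d)
    (w : 'I_n2 -> 'cV[R]_d) :
  castmx (esym (mulnDl n1 n2 d), erefl 1%N) (col_mx (stack u) (stack w)) =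
  stack (fun i => (row i (col_mx (\matrix_i (u i)^T) (\matrix_i (w i)^T)))^T).
Proof.
apply/colP => r; case: (mxtens_indexP r) => i l.
rewrite castmxE /= stackE [cast_ord _ 0]ord1.
case: (split_ordP i) => i' ->.
  rewrite (_ : cast_ord _ _ = lshift (n2 * d) (mxtens_index (i', l))).
    by rewrite col_mxEu stackE [RHS]mxE [RHS]mxE col_mxEu !mxE.
  exact/val_inj.
rewrite (_ : cast_ord _ _ = rshift (n1 * d) (mxtens_index (i', l))).
  by rewrite col_mxEd stackE [RHS]mxE [RHS]mxE col_mxEd !mxE.
by apply/val_inj; rewrite /= mulnDl addnA.
Qed.

Lemma dot_trmx_mul {R : realType} n d (B : 'M[R]_(n, d)) u F :
  dot (B^T *m u) F = (u^T *m (B *m F)) 0 0.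
Proof.
have -> : dot (B^T *m u) F = ((B^T *m u)^T *m F) 0 0.
  by rewrite [RHS]mxE; apply: eq_bigr => i _; rewrite [in RHS]mxE.
by rewrite trmx_mul trmxK mulmxA.
Qed.

Lemma gap_translate {R : realType} (mu L : R) d (x y s u v : 'cV[R]_d) a b t :
  gap mu L (x - s) (y - s) u v (a - t) (b - t) = gap mu L x y u v a b.
Proof.
have E : x - s - (y - s) = x - y by rewrite opprB addrA subrK.
by rewrite /gap E; congr (_ * _ + _ - _); ring.
Qed.

Section Run.
Context {R : realType} {N : nat} (m : method R N) (mu L : R) (K : nat) {d : nat}
  (f : 'cV[R]_d -> R) (xs : 'cV[R]_d) (x : nat -> 'cV[R]_d).
Hypotheses (L_gt0 : 0 < L) (muL : mu < L)
  (sum_beta : \sum_(j < N.+1) beta m j = 1)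
  (sum_gamma : \sum_(j < N.+1) gamma m j = 1) (rx : run m mu L f xs x).

(** Centring at xs matches the zero rows of the star index. The centred iterates obey the same
    recurrence because the beta_j and the gamma_j sum to one. *)
Definition run_values : 'M[R]_(N + K + 2, d) :=
  basis_values K (fun n => x n - xs) (fun k => grad f (yseq m x k)).

Definition run_fvalues : 'cV[R]_K.+1 := \col_k (f (yseq m x k) - f xs).

Let grad_xs : grad f xs = 0.
Proof. by have [sf xmin _] := rx; exact: (grad_minimizer sf). Qed.

Let yseq_shift k : yseq m (fun n => x n - xs) k = yseq m x k - xs.
Proof.
rewrite /yseq; under eq_bigr do rewrite scalerBr.
by rewrite sumrB -scaler_suml sum_gamma scale1r.
Qed.

Let iterates_shift k : x (N + k).+1 - xs =
  \sum_(j < N.+1) beta m j *: (x (N + k - j)%N - xs)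
  - alpha m *: grad f (yseq m x k).
Proof.
have [_ _ ->] := rx; under [in RHS]eq_bigr do rewrite scalerBr.
by rewrite sumrB -scaler_suml sum_beta scale1r addrAC.
Qed.

Lemma quad_lyapunov_run P p k : (N <= k <= K)%N ->
  quad_lyapunov P p (state m f xs x k) =
  gram_form (Vk m K k P) run_values + dot (vk K k p) run_fvalues.
Proof.
move=> /andP[Nk kK]; rewrite /quad_lyapunov /state /= castmx_stack quad_tens1.
congr (_ + _).
  rewrite /Vk; set Y := col_mx (xblock m K k) _.
  have -> : gram_form (Y^T *m P *m Y) run_values = gram_form P (Y *m run_values).
    by rewrite /gram_form trmx_mul !mulmxA.
  congr gram_form; rewrite mul_col_mx; congr col_mx; apply/row_matrixP => i.
    rewrite row_mul !rowK -[RHS]trmxK xbar_basis_values//.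
    by rewrite (leq_trans (leq_subr _ _))// leqW// leq_add2l.
  rewrite row_mul !rowK -[RHS]trmxK gbar_basis_values ?grad_xs ?subr0//.
  exact: leq_trans (leq_subr _ _) kK.
rewrite /vk dot_trmx_mul; congr (_ 0 0); congr (_ *m _).
apply/colP => i; rewrite !mxE.
have iK : (k - i < K.+1)%N by rewrite ltnS (leq_trans (leq_subr _ _)).
have /matrixP/(_ 0 0) := unit_row_mul run_fvalues iK.
by rewrite !mxE => <-; apply: eq_bigr => j _; rewrite !mxE.
Qed.

Lemma gap_run (i j : idx K) : 0 <= gram_form (Mij m mu L i j) run_values
  + dot (mij mu L i j) run_fvalues.
Proof.
have [sf _ _] := rx; pose pt (i : idx K) := if i is Some k then yseq m x k else xs.
have yE i' : (ybar_idx m i' *m run_values)^T = pt i' - xs.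
  case: i' => [k|] /=; last by rewrite mul0mx trmx0 subrr.
  by rewrite ybar_basis_values ?yseq_shift// leqW// -ltnS.
have gE i' : (gbar_idx R N i' *m run_values)^T = grad f (pt i').
  case: i' => [k|] /=; last by rewrite mul0mx trmx0 grad_xs.
  by rewrite gbar_basis_values// -ltnS.
have fE i' : (fbar_idx R i' *m run_fvalues) 0 0 = f (pt i') - f xs.
  by rewrite fbar_idx_mul; case: i' => [k|]; rewrite ?mxE ?subrr.
by rewrite Mij_gap !yE !gE !fE gap_translate; exact: gap_ge0.
Qed.

Lemma run_fvalues_ge0 k : 0 <= run_fvalues k 0.
Proof. by rewrite mxE subr_ge0; have [_ xmin _] := rx; exact: xmin. Qed.

End Run.

Section State.
Context {R : realType} {N d : nat}.

Definition unstack (n : nat) (u : 'cV[R]_(n * d)) : 'M[R]_(n, d) :=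
  \matrix_(i, l) u (mxtens_index (i, l)) 0.

Definition state_matrix (xi : stateT R N d) : 'M[R]_(N.+1 + N.+1, d) :=
  col_mx (unstack xi.1.1) (unstack xi.1.2).

Lemma unstackK n (u : 'cV[R]_(n * d)) : stack (fun i => (row i (unstack u))^T) = u.
Proof.
by apply/colP => r; case: (mxtens_indexP r) => i l; rewrite stackE !mxE.
Qed.

Lemma quad_lyapunovE P p (xi : stateT R N d) :
  quad_lyapunov P p xi = gram_form P (state_matrix xi) + dot p xi.2.
Proof.
rewrite /quad_lyapunov -{1}(unstackK xi.1.1) -{1}(unstackK xi.1.2).
rewrite castmx_stack quad_tens1; congr (gram_form P _ + _).
  by congr col_mx; apply/row_matrixP => i; rewrite rowK trmxK.
by rewrite mxE; apply: eq_bigr => i _; rewrite mxE.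
Qed.

Lemma continuous_quad_lyapunov P p : continuous (@quad_lyapunov R N d P p).
Proof.
have c1 : continuous (fun xi : stateT R N d => xi.1) by move=> xi; exact: cvg_fst.
have cx i : continuous (fun xi : stateT R N d => xi.1.1 i 0).
  move=> xi; apply: (@continuous_comp _ _ _ (fun xi : stateT R N d => xi.1.1)
    (fun u : 'cV[R]_(N.+1 * d) => u i 0)); last exact: coord_continuous.
  by apply: (@continuous_comp _ _ _ (fun xi : stateT R N d => xi.1) fst);
    [exact: c1|exact: cvg_fst].
have cg i : continuous (fun xi : stateT R N d => xi.1.2 i 0).
  move=> xi; apply: (@continuous_comp _ _ _ (fun xi : stateT R N d => xi.1.2)
    (fun u : 'cV[R]_(N.+1 * d) => u i 0)); last exact: coord_continuous.
  by apply: (@continuous_comp _ _ _ (fun xi : stateT R N d => xi.1) snd);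
    [exact: c1|exact: cvg_snd].
have cf i : continuous (fun xi : stateT R N d => xi.2 i 0).
  move=> xi; apply: (@continuous_comp _ _ _ (fun xi : stateT R N d => xi.2)
    (fun u : 'cV[R]_N.+1 => u i 0)); last exact: coord_continuous.
  exact: cvg_snd.
have cW i l : continuous (fun xi => state_matrix xi i l).
  case: (split_ordP i) => i' ->; rewrite /state_matrix.
    rewrite (_ : (fun xi => _) = fun xi : stateT R N d =>
      xi.1.1 (mxtens_index (i', l)) 0)//.
    by apply/funext => xi; rewrite col_mxEu mxE.
  rewrite (_ : (fun xi => _) = fun xi : stateT R N d =>
    xi.1.2 (mxtens_index (i', l)) 0)//.
  by apply/funext => xi; rewrite col_mxEd mxE.
rewrite (_ : @quad_lyapunov R N d P p = fun xi =>
  gram_form P (state_matrix xi) + dot p xi.2).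
  by apply: continuous_add; [exact: continuous_gram_form|exact: continuous_dot].
by apply/funext => xi; rewrite quad_lyapunovE.
Qed.

(** |x|^2 + |g|^2 + sum f, written as an instance of [quad_lyapunov] so that [quad_lyapunov_run]
    also expresses it in the bases of the SDP. *)
Definition state_size (xi : stateT R N d) : R :=
  quad_lyapunov 1%:M (const_mx 1) xi.

Lemma state_sizeE xi : state_size xi =
  mdot (state_matrix xi) (state_matrix xi) + \sum_i xi.2 i 0.
Proof.
rewrite /state_size quad_lyapunovE /gram_form mulmx1; congr (_ + _).
by apply: eq_bigr => i _; rewrite mxE mul1r.
Qed.

Lemma state_norm_le (xi : stateT R N d) : (forall i, 0 <= xi.2 i 0) ->
  `|xi| <= 1 + state_size xi.
Proof.
move=> f0; have s0 : 0 <= \sum_i xi.2 i 0 by rewrite sumr_ge0.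
have m0 := mdot_ge0 (state_matrix xi).
have sq (t : R) : `|t| <= 1 + t ^+ 2.
  by rewrite ler_norml; apply/andP; split; have := sqr_ge0 (t - 1);
    have := sqr_ge0 (t + 1); nra.
have bW i l : `|state_matrix xi i l| <= 1 + state_size xi.
  apply: le_trans (sq _) _; rewrite lerD2l state_sizeE.
  by apply: le_trans (mdot_entry _ i l) _; rewrite lerDl.
have s1 : 0 <= 1 + state_size xi by rewrite state_sizeE !addr_ge0.
rewrite !prod_normE /= !ge_max; apply/andP; split.
  apply/andP; split; apply: ler_mx_norm => // r c; rewrite ord1;
    case: (mxtens_indexP r) => i l.
    by have := bW (lshift _ i) l; rewrite col_mxEu mxE.
  by have := bW (rshift _ i) l; rewrite col_mxEd mxE.
apply: ler_mx_norm => // i j; rewrite ord1 ger0_norm// state_sizeE.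
apply: (@le_trans _ _ (\sum_i xi.2 i 0)); last by rewrite addrA lerDr addr_ge0.
by rewrite (bigD1 i)//= lerDl sumr_ge0.
Qed.

Lemma state_size_eq0 (xi : stateT R N d) : (forall i, 0 <= xi.2 i 0) ->
  state_size xi = 0 -> xi = 0.
Proof.
rewrite state_sizeE => f0 s0; have sf : 0 <= \sum_i xi.2 i 0 by rewrite sumr_ge0.
have m0 := mdot_ge0 (state_matrix xi).
have W0 : state_matrix xi = 0 by apply: mdot_eq0; lra.
have /psumr_eq0P F0 : \sum_i xi.2 i 0 = 0 by lra.
have {}F0 i : xi.2 i 0 = 0 by apply: F0.
move: W0 F0 {f0 s0 sf m0}; case: xi => [[u w] c] /= W0 F0.
move: W0; rewrite /state_matrix /= -[RHS]col_mx0 => /eq_col_mx[u0 w0].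
have st0 n (v : 'cV[R]_(n * d)) : unstack v = 0 -> v = 0.
  move=> v0; rewrite -(unstackK v) v0; apply/colP => r.
  by case: (mxtens_indexP r) => i l; rewrite stackE !mxE.
rewrite (st0 _ _ u0) (st0 _ _ w0) (_ : c = 0)//.
by apply/colP => i; rewrite mxE F0.
Qed.

End State.

Section TimeShift.
Context {R : realType} {N : nat} (m : method R N) (mu L : R) {d : nat}
  (f : 'cV[R]_d -> R) (xs : 'cV[R]_d) (x : nat -> 'cV[R]_d) (s : nat).
Let x' n := x (n + s)%N.

Let yseq_time_shift k : yseq m x' k = yseq m x (k + s).
Proof.
apply: eq_bigr => j _; congr (_ *: x _).
by have := ltn_ord j; lia.
Qed.

(** With [run_time_shift], reduces every state at k >= N to the state at N of a delayed run. *)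
Lemma state_time_shift k : (N <= k)%N ->
  state m f xs x (k + s) = state m f xs x' k.
Proof.
move=> Nk; rewrite /state; have sE (i : 'I_N.+1) : (k + s - i = k - i + s)%N.
  by have := ltn_ord i; lia.
have E1 : (fun i : 'I_N.+1 => x (N + (k + s) - i)%N - xs) =
    (fun i : 'I_N.+1 => x' (N + k - i)%N - xs).
  by apply/funext => i; congr (x _ - _); have := ltn_ord i; lia.
have E2 : (fun i : 'I_N.+1 => grad f (yseq m x (k + s - i)) - grad f xs) =
    (fun i : 'I_N.+1 => grad f (yseq m x' (k - i)) - grad f xs).
  by apply/funext => i; rewrite sE yseq_time_shift.
have E3 : \col_(i < N.+1) (f (yseq m x (k + s - i)) - f xs) =
    \col_(i < N.+1) (f (yseq m x' (k - i)) - f xs).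
  by apply/colP => i; rewrite !mxE sE yseq_time_shift.
by rewrite E1 E2 E3.
Qed.

Lemma run_time_shift : run m mu L f xs x -> run m mu L f xs x'.
Proof.
move=> [sf xmin it]; split; [exact: sf|exact: xmin|move=> k].
rewrite /x' addSn -addnA (it (k + s)%N) yseq_time_shift.
congr (_ - _); apply: eq_bigr => j _; congr (_ *: x _).
by have := ltn_ord j; lia.
Qed.

End TimeShift.

(** * From the semidefinite program to the Lyapunov function *)

Lemma dot_nneg {R : realType} n (u v : 'cV[R]_n) :
  (forall i, 0 <= u i 0) -> (forall i, 0 <= v i 0) -> 0 <= dot u v.
Proof. by move=> u0 v0; apply: sumr_ge0 => i _; rewrite mulr_ge0. Qed.

Lemma quad_le_dot {R : realType} n (D : 'M[R]_n) :
  exists2 B, 0 < B & forall z, quad D z <= B * dot z z.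
Proof.
pose B := \sum_j \sum_i `|D i j|.
have B0 : 0 <= B by do 2!apply: sumr_ge0 => ? _.
exists (B + 1) => [|z]; first by rewrite ltr_wpDl.
apply: (@le_trans _ _ (B * dot z z)); last first.
  by rewrite ler_wpM2r ?dot_ge0// lerDl.
rewrite quadE mulr_suml; apply: ler_sum => j _; rewrite mulr_suml.
apply: ler_sum => i _; apply: le_trans (ler_norm _) _.
rewrite mulrAC normrM mulrC ler_wpM2l//.
have entry k : z k 0 ^+ 2 <= dot z z.
  rewrite /dot (bigD1 k)//= expr2 lerDl; apply: sumr_ge0 => l _.
  by rewrite -expr2 sqr_ge0.
have := entry i; have := entry j; rewrite ler_norml.
have := sqr_ge0 (z i 0 - z j 0); have := sqr_ge0 (z i 0 + z j 0).
by move=> H1 H2 H3 H4; apply/andP; split; nra.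
Qed.

Lemma posdef_ge_dot {R : realType} n (W : 'M[R]_n) : posdef W ->
  exists2 c, 0 < c & forall z, c * dot z z <= quad W z.
Proof.
(* The constant is the minimum of the form on the unit sphere, which is empty for n = 0. *)
move=> Wp; case: n => [|n] in W Wp *.
  exists 1 => // z; rewrite /dot big_ord0 mulr0.
  by rewrite (_ : z = 0) ?/quad ?mulmx0 ?mxE//; apply/colP => -[].
pose A := [set u : 'rV[R]_n.+1 | dot u^T u^T = 1].
have ctr i : continuous (fun u : 'rV[R]_n.+1 => u^T i 0).
  rewrite (_ : (fun u => _) = fun u : 'rV[R]_n.+1 => u 0 i).
    exact: coord_continuous.
  by apply/funext => u; rewrite mxE.
have cdot : continuous (fun u : 'rV[R]_n.+1 => dot u^T u^T).
  by apply: continuous_sum => i _; exact: continuous_mul.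
have cq : continuous (fun u : 'rV[R]_n.+1 => quad W u^T).
  rewrite (_ : (fun u => _) = fun u : 'rV[R]_n.+1 => gram_form W u^T).
    by apply: continuous_gram_form => i l; rewrite ord1.
  by apply/funext => u; rewrite quad_gram_form.
have clA : closed A.
  rewrite (_ : A = [set u | dot u^T u^T <= 1] `&` [set u | 1 <= dot u^T u^T]).
    by apply: closedI; [exact: closed_sublevel|exact: closed_superlevel].
  apply/seteqP; split=> u /=; first by move=> ->.
  by move=> [H1 H2]; apply/eqP; rewrite eq_le H1 H2.
have A0 : A (delta_mx 0 0).
  by rewrite /A /= trmx_delta dot_delta mxE eqxx.
have [|u Au umin] := argmin_rV (C := 1) cq clA A0.
  move=> u Au _ i; have : u 0 i ^+ 2 <= 1.
    rewrite -Au /dot (bigD1 i)//= !mxE -expr2 lerDl.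
    by apply: sumr_ge0 => j _; rewrite -expr2 sqr_ge0.
  by rewrite -real_normK ?num_real// expr_le1.
have u0 : u^T != 0.
  apply: contra_eq_neq Au => ->; rewrite dot0l eq_sym; exact: oner_neq0.
exists (quad W u^T) => [|z]; first exact: Wp.
have [->|z0] := eqVneq z 0; first by rewrite dot0l mulr0 /quad mulmx0 mxE.
have d0 : 0 < dot z z.
  by rewrite lt_neqAle dot_ge0 andbT eq_sym; apply: contraNneq z0 => /dot_eq0 ->.
pose s := Num.sqrt (dot z z); have s2 : s ^+ 2 = dot z z by rewrite sqr_sqrtr// ltW.
have sn : s != 0 by rewrite gt_eqF// sqrtr_gt0.
have := umin (s^-1 *: z)^T; rewrite /A /= trmxK dotZl dotZr -s2.
have -> : quad W (s^-1 *: z) = s^-1 ^+ 2 * quad W z.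
  by rewrite !quad_gram_form gram_form_scale.
move=> H; have {}H : quad W u^T <= s^-1 ^+ 2 * quad W z by apply: H; field.
by rewrite -ler_pdivlMr ?s2// -s2 mulrC -exprVn.
Qed.

Lemma posdef_perturbation {R : realType} n (W D : 'M[R]_n) : posdef W ->
  exists2 e, 0 < e & forall t, 0 <= t <= e -> possemidef (W - t *: D).
Proof.
move=> /posdef_ge_dot[c c0 cW]; have [B B0 DB] := quad_le_dot D.
exists (c / B) => [|t /andP[t0 te] z]; first exact: divr_gt0.
rewrite quad_gram_form gram_formD gram_formN gram_formZ -!quad_gram_form subr_ge0.
apply: le_trans (cW z); apply: le_trans (ler_wpM2l t0 (DB z)) _.
by rewrite mulrA ler_wpM2r ?dot_ge0// -ler_pdivlMr.
Qed.

Lemma pos_perturbation {R : realType} n (w v : 'cV[R]_n) :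
    (forall i, 0 < w i 0) ->
  exists2 e, 0 < e & forall t, 0 <= t <= e -> forall i, 0 <= (w - t *: v) i 0.
Proof.
move=> w0; exists (\big[Num.min/1]_i (w i 0 / (`|v i 0| + 1))) => [|t].
  by apply/bigmin_gtP; split=> // i _; rewrite divr_gt0 ?ltr_wpDl.
move=> /andP[t0 te] i; rewrite !mxE subr_ge0.
have : t <= w i 0 / (`|v i 0| + 1) by apply: le_trans te _; exact: bigmin_le.
rewrite ler_pdivlMr ?ltr_wpDl// => H; apply: le_trans H.
by rewrite ler_wpM2l// (le_trans (ler_norm _))// lerDl.
Qed.

Section Sufficiency.
Context {R : realType} {N : nat} (m : method R N) (mu L rho : R).
Hypotheses (L_gt0 : 0 < L) (muL : mu < L)
  (sum_beta : \sum_(j < N.+1) beta m j = 1)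
  (sum_gamma : \sum_(j < N.+1) gamma m j = 1).

Lemma gap_run_sum K d f xs x (c : idx K -> idx K -> R) :
  @run R N m d mu L f xs x -> (forall i j, 0 <= c i j) ->
  0 <= gram_form (\sum_(i : idx K) \sum_(j : idx K) c i j *: Mij m mu L i j)
         (run_values m K f xs x)
     + dot (\sum_(i : idx K) \sum_(j : idx K) c i j *: mij mu L i j)
         (run_fvalues m K f xs x).
Proof.
move=> rx c0; rewrite gram_form_sum dot_suml -big_split sumr_ge0// => i _ /=.
rewrite gram_form_sum dot_suml -big_split sumr_ge0// => j _ /=.
by rewrite gram_formZ dotZl -mulrDr mulr_ge0//; exact: (gap_run L_gt0 muL sum_beta sum_gamma rx).
Qed.

Lemma rho_SDP_feasible_lyapunov :
  rho_SDP_feasible m mu L rho -> lyapunov_exists m mu L rho.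
Proof.
move=> [P [p [lam [eta [[Ps lam0 eta0] [Wp wp Dp dp]]]]]]; exists P, p.
split=> // d; set W := Vk _ _ _ _ - _ in Wp; set w := vk _ _ _ - _ in wp.
(* The strict inequalities leave room to subtract e times the data of [state_size]; this is what
   makes V coercive. *)
have [e1 e10 e1P] := posdef_perturbation (Vk m N N 1%:M) Wp.
have [e2 e20 e2P] := pos_perturbation (vk N N (const_mx 1 : 'cV[R]_N.+1)) wp.
pose e := Num.min e1 e2; have e0 : 0 < e by rewrite lt_min e10.
have eP : possemidef (W - e *: Vk m N N 1%:M).
  by apply: e1P; rewrite ltW//= ge_min lexx.
have ep : forall i, 0 <= (w - e *: vk N N (const_mx 1 : 'cV[R]_N.+1)) i 0.
  by apply: e2P; rewrite ltW//= ge_min lexx orbT.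
have gen (xi : stateT R N d) : generated m mu L xi -> exists f xs x,
    run m mu L f xs x /\ xi = state m f xs x N.
  move=> [f [xs [x [k [rx Nk ->]]]]]; exists f, xs, (fun n => x (n + (k - N))%N).
  by split; [exact: run_time_shift|rewrite -state_time_shift// subnKC].
have f_ge0 (xi : stateT R N d) : generated m mu L xi -> forall i, 0 <= xi.2 i 0.
  move=> [f [xs [x [k [[_ xmin _] _ ->]]]]] i; rewrite mxE subr_ge0.
  exact: xmin.
have V_ge (xi : stateT R N d) : generated m mu L xi -> e * state_size xi <= quad_lyapunov P p xi.
  move=> xig; have [f [xs [x [rx ->]]]] := gen _ xig.
  have NN : (N <= N <= N)%N by rewrite leqnn.
  rewrite /state_size !(quad_lyapunov_run L_gt0 sum_beta rx _ _ NN).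
  have := gap_run_sum (K := N) rx lam0; have := possemidef_gram_form (run_values m N f xs x) eP.
  have := dot_nneg ep (run_fvalues_ge0 (K := N) rx).
  rewrite /W /w !(gram_formD, gram_formN, gram_formZ, dotDl, dotNl, dotZl).
  by lra.
have s_ge0 (xi : stateT R N d) : generated m mu L xi -> 0 <= state_size xi.
  by move=> xig; have xi0 := f_ge0 _ xig; rewrite state_sizeE addr_ge0 ?mdot_ge0 ?sumr_ge0.
split.
- exact: continuous_quad_lyapunov.
- move=> xi xig; apply: le_trans (V_ge _ xig).
  by rewrite mulr_ge0 ?s_ge0// ltW.
- move=> xi xig; split=> [V0|->].
    apply: state_size_eq0; first exact: f_ge0.
    apply/eqP; rewrite eq_le s_ge0// andbT -(pmulr_rle0 _ e0).
    by apply: le_trans (V_ge _ xig) _; rewrite V0.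
  rewrite quad_lyapunovE dot0r addr0 /gram_form.
  rewrite (_ : state_matrix 0 = 0) ?mulmx0 ?mxtrace0//.
  by rewrite /state_matrix -[RHS]col_mx0; congr col_mx; apply/matrixP => i j;
    rewrite !mxE.
(* By [state_norm_le], a norm above this bound forces e * [state_size] above |a|. *)
- move=> a; exists (1 + `|a| / e) => xi xig.
  move=> /lt_le_trans/(_ (state_norm_le (f_ge0 _ xig))).
  rewrite ltrD2l ltr_pdivrMr// mulrC => aV.
  exact: le_lt_trans (ler_norm a) (lt_le_trans aV (V_ge _ xig)).
- move=> f xs x0 rx0 k Nk; pose x n := x0 (n + (k - N))%N.
  have rx : run m mu L f xs x by exact: run_time_shift.
  have -> : state m f xs x0 k = state m f xs x N.
    by rewrite -state_time_shift// subnKC.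
  have -> : state m f xs x0 k.+1 = state m f xs x N.+1.
    by rewrite -state_time_shift ?leqnSn// addSn subnKC.
  have N1 : (N <= N <= N.+1)%N by rewrite leqnn leqnSn.
  have N2 : (N <= N.+1 <= N.+1)%N by rewrite leqnn leqnSn.
  rewrite (quad_lyapunov_run L_gt0 sum_beta rx _ _ N1).
  rewrite (quad_lyapunov_run L_gt0 sum_beta rx _ _ N2).
  have := gap_run_sum (K := N.+1) rx eta0; have := possemidef_gram_form (run_values m N.+1 f xs x) Dp.
  set dd := _ + _ in dp.
  have dn i : 0 <= (- dd) i 0 by rewrite mxE oppr_ge0.
  have := dot_nneg dn (run_fvalues_ge0 (K := N.+1) rx).
  rewrite /dd /DeltaV /Deltav.
  rewrite !(gram_formD, gram_formN, gram_formZ, dotDl, dotNl, dotZl).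
  by lra.
Qed.

End Sufficiency.

(** * From the Lyapunov function to the semidefinite program *)

Section Realization.
Context {R : realType} {N : nat} (m : method R N) (mu L : R) (K : nat) {d : nat}
  (Z : 'M[R]_(N + K + 2, d)) (F : 'cV[R]_K.+1).
Hypotheses (mu_gt0 : 0 < mu) (muL : mu < L)
  (gapZF : forall i j : idx K,
    0 <= gram_form (Mij m mu L i j) Z + dot (mij mu L i j) F).

(** Interpolate the points y_k and the star by f, then run the method on f from the first rows of Z:
    the gradient met at each y_k is the prescribed row, so the run reproduces Z. *)
Lemma run_realization : exists f x,
  [/\ run m mu L f 0 x, run_values m K f 0 x = Z & run_fvalues m K f 0 x = F].
Proof.
have [|f sf fP] := @smooth_strongly_convex_interpolation R d mu L (idx K) None
    (fun i => (ybar_idx m i *m Z)^T) (fun i => (gbar_idx R N i *m Z)^T)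
    (fun i => (fbar_idx R i *m F) 0 0) mu_gt0 muL.
  by move=> i j; rewrite -Mij_gap.
(* The star index prescribes value and gradient zero at the origin; strong convexity then makes 0
   the minimizer. *)
have [f0 gf0] : f 0 = 0 /\ grad f 0 = 0.
  by have := fP None; rewrite /= !mul0mx !trmx0 mxE.
have min0 : minimizer f 0.
  move=> z; have := strong_tangent sf 0 z; rewrite gf0 dot0l addr0 => H.
  apply: le_trans H; rewrite lerDl mulr_ge0 ?dot_ge0//.
  by rewrite divr_ge0// ltW.
have [x [x0 xS]] := iteration_exists m (grad f)
  (fun n => (unit_row R (N + K + 2) n *m Z)^T).
have xE n : (n <= (N + K).+1)%N -> x n = (xbar m K n *m Z)^T.
  elim/ltn_ind: n => n IH nNK; have [nN|] := leqP n N.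
    by rewrite x0// xbar_init.
  case: n => // n in IH nNK *; rewrite ltnS => Nn; pose k := (n - N)%N.
  have nE : n = (N + k)%N by rewrite subnKC.
  have kK : (k < K.+1)%N by move: nNK; rewrite nE !ltnS leq_add2l.
  have xj (j : 'I_N.+1) : x (N + k - j)%N = (xbar m K (N + k - j) *m Z)^T.
    by apply: IH; lia.
  rewrite nE xS xbar_step mulmxBl mulmx_suml linearB/= linear_sum/=.
  congr (_ - _).
    by apply: eq_bigr => j _; rewrite -scalemxAl linearZ/= xj.
  rewrite -scalemxAl linearZ/=; have [_ <-] := fP (Some (Ordinal kK)).
  congr (_ *: grad f _); rewrite mulmx_suml linear_sum/=.
  by apply: eq_bigr => j _; rewrite -scalemxAl linearZ/= xj.
have yE (k : 'I_K.+1) : yseq m x k = (ybar_idx m (Some k) *m Z)^T.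
  rewrite mulmx_suml linear_sum/=; apply: eq_bigr => j _.
  by rewrite -scalemxAl linearZ/= xE//; have := ltn_ord k; lia.
exists f, x; split; first by split.
  apply/matrixP => i l; rewrite !mxE; case: ifP => iN.
    by rewrite subr0 x0// (unit_row_mul _ (ltn_ord i)) !mxE; congr (Z _ _);
      apply/val_inj.
  have kK : (i - N.+1 < K.+1)%N by have := ltn_ord i; lia.
  have -> : (i - N.+1)%N = Ordinal kK :> nat by [].
  rewrite yE; have [_ /colP/(_ l)] := fP (Some (Ordinal kK)).
  rewrite [LHS]mxE => ->; rewrite /= /gbar.
  have iE : (N + (i - N.+1) + 1 = i)%N by lia.
  rewrite iE (unit_row_mul _ (ltn_ord i)) !mxE; congr (Z _ _).
  exact/val_inj.
apply/colP => k; rewrite mxE yE f0 subr0; have [-> _] := fP (Some k).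
by rewrite fbar_idx_mul.
Qed.

End Realization.

Section SlaterDuality.
Context {R : realType} {N : nat} (m : method R N) (mu L : R) (K : nat).
Hypotheses (muL : mu < L) (alpha0 : alpha m != 0) (gamma0 : gamma m ord0 != 0).

Lemma interpolation_duality (A : 'M[R]_(N + K + 2)) (a : 'cV[R]_K.+1) :
  (forall (Z : 'M[R]_(N + K + 2)) F,
    (forall i j : idx K,
      0 <= gram_form (Mij m mu L i j) Z + dot (mij mu L i j) F) ->
    0 <= gram_form A Z + dot a F) ->
  exists c : idx K -> idx K -> R,
    [/\ forall i j, 0 <= c i j,
      possemidef (A - \sum_(i : idx K) \sum_(j : idx K) c i j *: Mij m mu L i j)
    & a = \sum_(i : idx K) \sum_(j : idx K) c i j *: mij mu L i j].
Proof.
(* The gap of (i, i) vanishes identically and would violate Slater's condition, so duality runs over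
   i != j and the multipliers are extended by 0 to the diagonal. *)
move=> primal; pose S := [set ij : idx K * idx K | ij.1 != ij.2].
pose M (r : 'I_#|S|) := Mij m mu L (enum_val r).1 (enum_val r).2.
pose v (r : 'I_#|S|) : 'cV[R]_K.+1 := mij mu L (enum_val r).1 (enum_val r).2.
have gap_ii i (Z : 'M[R]_(N + K + 2)) F :
    gram_form (Mij m mu L i i) Z + dot (mij mu L i i) F = 0.
  by rewrite Mij_gap /gap !subrr !dot0r !mulr0 addr0 mul0r subrr.
have [Z F ZF||l [l0 lA la]] := @conic_duality R _ _ _ A a M v.
- apply: primal => i j; have [->|ij] := eqVneq i j; first by rewrite gap_ii.
  have ijS : (i, j) \in S by rewrite inE.
  by have := ZF (enum_rank_in ijS (i, j)); rewrite /M /v enum_rankK_in.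
- have [Z [F ZF]] := slater_point muL alpha0 gamma0 K; exists 1%N, Z, F => r.
  by apply: ZF; have := enum_valP r; rewrite inE.
pose c i j := if [pick r | enum_val r == (i, j) :> _ * _] is Some r then l r else 0.
have cE r : c (enum_val r).1 (enum_val r).2 = l r.
  rewrite /c; case: pickP => [s /eqP|/(_ r)]; last by rewrite -surjective_pairing eqxx.
  by rewrite -surjective_pairing => /enum_val_inj ->.
have sumE (V : lmodType R) (G : idx K -> idx K -> V) :
    \sum_(i : idx K) \sum_(j : idx K) c i j *: G i j =
    \sum_r l r *: G (enum_val r).1 (enum_val r).2.
  rewrite pair_bigA /= (bigID (mem S)) /= [X in _ + X]big1 ?addr0; last first.
    move=> [i j] ijS; rewrite /c; case: pickP => [r /eqP rE|_]; last by rewrite scale0r.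
    by case/negP: ijS; rewrite /= -rE enum_valP.
  rewrite big_enum_val; apply: eq_bigr => r _; by rewrite cE.
exists c; split=> [i j||]; last by rewrite sumE.
  by rewrite /c; case: pickP.
by rewrite sumE.
Qed.

End SlaterDuality.

(* By compactness of the section |Z|^2 + sum F = 1 of the cone. *)
Lemma positive_on_cone {R : realType} n k (J : Type) (M : J -> 'M[R]_n)
    (v : J -> 'cV[R]_k) (A : 'M[R]_n) (a : 'cV[R]_k)
    (feas := fun (Z : 'M[R]_n) F => forall j, 0 <= gram_form (M j) Z + dot (v j) F)
    (size := fun (Z : 'M[R]_n) (F : 'cV[R]_k) =>
      gram_form 1%:M Z + dot (const_mx 1) F) :
    (forall Z F, feas Z F -> forall i, 0 <= F i 0) ->
    (forall Z F, feas Z F -> size Z F != 0 -> 0 < gram_form A Z + dot a F) ->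
  exists2 c, 0 < c &
    forall Z F, feas Z F -> c * size Z F <= gram_form A Z + dot a F.
Proof.
move=> F0 pos; pose val (Z : 'M[R]_n) F := gram_form A Z + dot a F.
have sF Z (F : 'cV[R]_k) : size Z F = mdot Z Z + \sum_i F i 0.
  rewrite /size /gram_form mulmx1; congr (_ + _).
  by apply: eq_bigr => i _; rewrite mxE mul1r.
have size_ge0 Z F : feas Z F -> 0 <= size Z F.
  by move=> /F0 ZF; rewrite sF addr_ge0 ?mdot_ge0 ?sumr_ge0.
have size0 Z F : feas Z F -> size Z F = 0 -> val Z F = 0.
  move=> /F0 ZF; rewrite sF => s0; have m0 := mdot_ge0 Z.
  have f0 : 0 <= \sum_i F i 0 by rewrite sumr_ge0.
  have Z0 : Z = 0 by apply: mdot_eq0; lra.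
  have /psumr_eq0P F_0 : \sum_i F i 0 = 0 by lra.
  rewrite /val Z0 /gram_form mulmx0 mxtrace0 add0r (_ : F = 0) ?dot0r//.
  by apply/colP => i; rewrite mxE F_0.
(* Gram terms are quadratic in Z but values are linear in F, so the cone is invariant under (Z, F)
   -> (s Z, s^2 F), and all forms scale by s^2. *)
have scale (Z : 'M[R]_n) (F : 'cV[R]_k) t : 0 < t -> let Z' := t^-1 *: Z in let F' := t^-1 ^+ 2 *: F in
    forall (B : 'M[R]_n) b, gram_form B Z' + dot b F' =
      t^-1 ^+ 2 * (gram_form B Z + dot b F).
  by move=> t0 /= B b; rewrite gram_form_scale dotZr mulrDr.
have norm Z F : feas Z F -> 0 < size Z F -> let t := Num.sqrt (size Z F) in
    let Z' := t^-1 *: Z in let F' := t^-1 ^+ 2 *: F in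
    [/\ feas Z' F', size Z' F' = 1 & val Z F = size Z F * val Z' F'].
  move=> ZF s0 t; have t0 : 0 < t by rewrite sqrtr_gt0.
  have tt : size Z F * t^-1 ^+ 2 = 1.
    by rewrite -(sqr_sqrtr (ltW s0)) -exprMn divff ?expr1n// gt_eqF.
  split=> [j||]; rewrite ?(scale _ _ _ t0)//.
  - by rewrite mulr_ge0 ?exprn_ge0// invr_ge0 ltW.
  - by rewrite /size (scale _ _ _ t0) mulrC.
  - by rewrite /val (scale _ _ _ t0) mulrA tt mul1r.
(* If the section is empty, every feasible point has size 0, where both sides vanish, and any c will
   do. *)
have [[Z0 [F0' [ZF0 s0]]]|none] :=
  pselect (exists Z F, feas Z F /\ size Z F = 1); last first.
  exists 1 => // Z F ZF; have [s0|s0] := ltP 0 (size Z F).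
    case: none; have [ZF' s1 _] := norm _ _ ZF s0.
    by do 2!eexists; split; [exact: ZF'|exact: s1].
  have s_0 : size Z F = 0 by apply/eqP; rewrite eq_le s0 size_ge0.
  by rewrite -/(val Z F) s_0 mulr0 size0.
pose Zu (u : 'rV[R]_(n * n + k)) : 'M[R]_n :=
  \matrix_(i, j) u 0 (lshift k (mxvec_index i j)).
pose Fu (u : 'rV[R]_(n * n + k)) : 'cV[R]_k := \col_i u 0 (rshift (n * n) i).
pose flat (Z : 'M[R]_n) (F : 'cV[R]_k) := row_mx (mxvec Z) F^T.
have Zflat Z F : Zu (flat Z F) = Z.
  by apply/matrixP => i j; rewrite mxE row_mxEl mxvecE.
have Fflat Z F : Fu (flat Z F) = F.
  by apply/colP => i; rewrite mxE row_mxEr mxE.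
have cZ i j : continuous (fun u => Zu u i j).
  rewrite (_ : (fun u => _) = fun u : 'rV[R]_(n * n + k) =>
    u 0 (lshift k (mxvec_index i j))); first exact: coord_continuous.
  by apply/funext => u; rewrite mxE.
have cF i : continuous (fun u => Fu u i 0).
  rewrite (_ : (fun u => _) = fun u : 'rV[R]_(n * n + k) =>
    u 0 (rshift (n * n) i)); first exact: coord_continuous.
  by apply/funext => u; rewrite mxE.
have cval (B : 'M[R]_n) b : continuous (fun u => gram_form B (Zu u) + dot b (Fu u)).
  by apply: continuous_add; [exact: continuous_gram_form|exact: continuous_dot].
pose D := [set u | feas (Zu u) (Fu u)] `&`
  ([set u | size (Zu u) (Fu u) <= 1] `&` [set u | 1 <= size (Zu u) (Fu u)]).
have clD : closed D.
  apply: closedI; first by apply: closed_forall => j; exact: closed_superlevel.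
  have cs := cval 1%:M (const_mx 1).
  by apply: closedI; [exact: closed_sublevel cs|exact: closed_superlevel cs].
have D0 : D (flat Z0 F0') by rewrite /D /= Zflat Fflat s0 lexx.
have [u [ZFu [su1 _]] _ i|u [ZFu [_ su1]] umin] :=
    argmin_rV (C := 1) (cval A a) clD D0.
  have := F0 _ _ ZFu => Fu0; move: su1; rewrite /= sF => su1.
  have m0 := mdot_ge0 (Zu u).
  have f0 : 0 <= \sum_i Fu u i 0 by rewrite sumr_ge0.
  case: (split_ordP i) => r ->.
    case/mxvec_indexP: r => i' j'; have := mdot_entry (Zu u) i' j'.
    rewrite mxE => H; have : u 0 (lshift k (mxvec_index i' j')) ^+ 2 <= 1.
      by apply: le_trans H _; lra.
    by rewrite -real_normK ?num_real// expr_le1.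
  have : Fu u r 0 <= \sum_i Fu u i 0 by rewrite (bigD1 r)//= lerDl sumr_ge0.
  have := Fu0 r; rewrite mxE => H1 H2; rewrite ger0_norm//; lra.
exists (val (Zu u) (Fu u)) => [|Z F ZF].
  by apply: pos ZFu _; rewrite gt_eqF// (lt_le_trans _ su1).
have [s_gt0|s_le0] := ltP 0 (size Z F); last first.
  have s_0 : size Z F = 0 by apply/eqP; rewrite eq_le s_le0 size_ge0.
  by rewrite -/(val Z F) s_0 mulr0 size0.
have [ZF' s1 valE] := norm _ _ ZF s_gt0.
rewrite -/(val Z F) valE mulrC ler_pM2l//.
move: ZF' s1; set Z1 := _ *: Z; set F1 := _ *: F => ZF1 s1.
have D1 : D (flat Z1 F1) by rewrite /D /= Zflat Fflat s1 lexx.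
by have := umin _ D1; rewrite /= Zflat Fflat.
Qed.

Section Necessity.
Context {R : realType} {N : nat} (m : method R N) (mu L rho : R).
Hypotheses (mu_gt0 : 0 < mu) (muL : mu < L)
  (alpha0 : alpha m != 0) (gamma0 : gamma m ord0 != 0)
  (sum_beta : \sum_(j < N.+1) beta m j = 1)
  (sum_gamma : \sum_(j < N.+1) gamma m j = 1)
  (degree_N : beta m ord_max != 0 \/ gamma m ord_max != 0).
Let L_gt0 : 0 < L. Proof. exact: lt_trans muL. Qed.

(* The recurrence with leading coefficient [c ord_max != 0] can be run
   backwards in time. *)
Lemma backward_zero {V : lmodType R} (c : 'I_N.+1 -> R) (z : nat -> V) :
  c ord_max != 0 -> (forall n, (N <= n <= N + N)%N -> z n = 0) ->
  (forall k, (k < N)%N -> \sum_(j < N.+1) c j *: z (N + k - j)%N = 0) ->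
  forall n, (n <= N + N)%N -> z n = 0.
Proof.
move=> c0 z0 zS; suff H t n : (N - t <= n <= N + N)%N -> z n = 0.
  by move=> n nN; apply: (H N); rewrite subnn.
elim: t n => [|t IH] n /andP[tn nN]; first by apply: z0; rewrite subn0 in tn; rewrite tn.
have [|nt] := leqP (N - t) n; first by move=> tn'; apply: IH; rewrite tn'.
have nN' : (n < N)%N by lia.
have := zS n nN'; rewrite big_ord_recr /= big1 ?add0r => [|j _].
  by rewrite addKn => /eqP; rewrite scaler_eq0 (negPf c0) => /eqP.
by rewrite IH ?scaler0//; have := ltn_ord j; rewrite /=; lia.
Qed.

(** The point is to recover the rows x_{-N}, ..., x_{-1}, which are absent from the state at k =
    N. *)
Lemma state_eq0 d (f : 'cV[R]_d -> R) xs x : run m mu L f xs x ->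
  state m f xs x N = 0 ->
  run_values m N f xs x = 0 /\ run_fvalues m N f xs x = 0.
Proof.
move=> rx s0; have [sf xmin it] := rx.
have gxs : grad f xs = 0 by exact: (grad_minimizer sf).
have x0 : stack (fun i : 'I_N.+1 => x (N + N - i)%N - xs) = 0 by case: s0.
have g0 : stack (fun i : 'I_N.+1 => grad f (yseq m x (N - i)) - grad f xs) = 0.
  by case: s0.
have f0 : \col_(i < N.+1) (f (yseq m x (N - i)) - f xs) = 0 by case: s0.
have stack0 n (u : 'I_n -> 'cV[R]_d) : stack u = 0 -> forall i, u i = 0.
  by move=> u0 i; apply/colP => l; rewrite -stackE u0 !mxE.
have rev n : (n <= N)%N -> exists i : 'I_N.+1, (N - i = n)%N.
  by move=> nN; exists (inord (N - n)); rewrite inordK ?subKn// ltnS leq_subr.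
have gk k : (k <= N)%N -> grad f (yseq m x k) = 0.
  by move=> /rev[i <-]; have := stack0 _ _ g0 i; rewrite gxs subr0.
have fk k : (k <= N)%N -> f (yseq m x k) - f xs = 0.
  by move=> /rev[i <-]; have /colP/(_ i) := f0; rewrite !mxE.
(* A zero gradient and the minimal value at y_k leave no room in the strong convexity inequality
   unless y_k = xs. *)
have yk k : (k <= N)%N -> yseq m x k = xs.
  move=> kN; have := strong_tangent sf (yseq m x k) xs.
  rewrite gk// dot0l addr0 => H; have fE := fk _ kN.
  apply/esym/eqP; rewrite -subr_eq0; apply/eqP/dot_eq0/eqP.
  rewrite eq_le dot_ge0 andbT -(pmulr_rle0 _ (_ : 0 < mu / 2)) ?divr_gt0//; lra.
pose z n := x n - xs.
have zN n : (N <= n <= N + N)%N -> z n = 0.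
  move=> /andP[n1 n2]; have [|i iE] := rev (n - N)%N; first by lia.
  have := stack0 _ _ x0 i; rewrite /z; congr (x _ - _ = 0).
  by have := ltn_ord i; lia.
have shift (c : 'I_N.+1 -> R) k : \sum_(j < N.+1) c j = 1 ->
    \sum_(j < N.+1) c j *: z (N + k - j)%N =
    \sum_(j < N.+1) c j *: x (N + k - j)%N - xs.
  move=> c1; under eq_bigr do rewrite scalerBr.
  by rewrite sumrB -scaler_suml c1 scale1r.
(* Two recurrences without gradient term: the update itself, since g_k = 0, and the definition of
   y_k, since y_k = xs. At least one has a nonzero last coefficient. *)
have zb k : (k < N)%N -> \sum_(j < N.+1) beta m j *: z (N + k - j)%N = 0.
  move=> kN; rewrite (shift _ _ sum_beta).
  have := it k; rewrite (gk _ (ltnW kN)) scaler0 subr0 => <-.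
  by apply: (zN (N + k).+1); lia.
have zg k : (k < N)%N -> \sum_(j < N.+1) gamma m j *: z (N + k - j)%N = 0.
  by move=> kN; rewrite (shift _ _ sum_gamma) -/(yseq m x k) (yk _ (ltnW kN)) subrr.
have z0 n : (n <= N + N)%N -> z n = 0.
  by case: degree_N => c0; [exact: (backward_zero c0 zN zb)|
    exact: (backward_zero c0 zN zg)].
split.
  apply/matrixP => i l; rewrite mxE; case: ifP => iN.
    by rewrite -/(z i) z0 ?mxE//; lia.
  by rewrite gk ?mxE//; have := ltn_ord i; lia.
by apply/colP => k; rewrite !mxE fk// -ltnS.
Qed.

Lemma lyapunov_rho_SDP_feasible :
  lyapunov_exists m mu L rho -> rho_SDP_feasible m mu L rho.
Proof.
move=> [P [p [Ps Ly]]].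
have [|Z F ZF s0|c c0 cP] := @positive_on_cone R _ _ (idx N * idx N)%type
    (fun ij => Mij m mu L ij.1 ij.2) (fun ij => mij mu L ij.1 ij.2)
    (Vk m N N P) (vk N N p).
- move=> Z F ZF i.
  have [|f [x [rx _ <-]]] := @run_realization R N m mu L N _ Z F mu_gt0 muL.
    by move=> i' j'; exact: (ZF (i', j')).
  exact: run_fvalues_ge0 rx i.
- have [|f [x [rx ZE FE]]] := @run_realization R N m mu L N _ Z F mu_gt0 muL.
    by move=> i' j'; exact: (ZF (i', j')).
  have [_ V0 Veq0 _ _] := Ly (N + N + 2)%N.
  have gen : generated m mu L (state m f 0 x N) by exists f, 0, x, N; split.
  have NN : (N <= N <= N)%N by rewrite leqnn.
  have VE := quad_lyapunov_run L_gt0 sum_beta rx P p NN; rewrite ZE FE in VE.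
  rewrite -VE lt_neqAle V0// andbT eq_sym; apply/eqP => /(Veq0 _ gen).
  move=> /(state_eq0 rx)[]; rewrite ZE FE => Z0 F0; case/eqP: s0.
  by rewrite Z0 F0 dot0r addr0 /gram_form mulmx0 mxtrace0.
(* The multipliers are sought for (V, v) - c (I, 1), still nonnegative on the cone; adding c (I, 1)
   back gives the strict inequalities. *)
have [Z F ZF|lam [lam0 lamV lamv]] := @interpolation_duality R N m mu L N muL
    alpha0 gamma0 (Vk m N N P - c *: 1%:M) (vk N N p - c *: const_mx 1).
  have := cP Z F (fun ij => ZF ij.1 ij.2).
  by rewrite gram_formD gram_formN gram_formZ dotBl dotZl; lra.
(* On the window K = N + 1 each feasible (Z, F) is a run through which both states, at N and N + 1,
   are read off, so the decrease of V is nonnegativity of this form. *)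
have [Z F ZF|eta [eta0 etaV etav]] := @interpolation_duality R N m mu L N.+1 muL
    alpha0 gamma0 (- DeltaV m N.+1 N rho P) (- Deltav N.+1 N rho p).
  have [f [x [rx <- <-]]] := run_realization mu_gt0 muL ZF.
  have N1 : (N <= N <= N.+1)%N by rewrite leqnn leqnSn.
  have N2 : (N <= N.+1 <= N.+1)%N by rewrite leqnn leqnSn.
  have [_ _ _ _ decr] := Ly (N + N.+1 + 2)%N.
  have := decr f 0 x rx N (leqnn N).
  rewrite (quad_lyapunov_run L_gt0 sum_beta rx _ _ N1).
  rewrite (quad_lyapunov_run L_gt0 sum_beta rx _ _ N2).
  rewrite /DeltaV /Deltav.
  by rewrite !(gram_formD, gram_formN, gram_formZ, dotDl, dotNl, dotZl); lra.
exists P, p, lam, eta; split=> //; split.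
- move=> z z0; have := lamV z.
  rewrite !quad_gram_form !(gram_formD, gram_formN, gram_formZ).
  have -> : gram_form 1%:M z = mdot z z by rewrite /gram_form mulmx1.
  have : 0 < c * mdot z z.
    rewrite mulr_gt0// lt_neqAle mdot_ge0 andbT eq_sym.
    by apply: contraNneq z0 => /mdot_eq0 ->.
  by lra.
- by move=> l; rewrite -lamv opprB addrC subrK !mxE mulr1.
- by rewrite opprD.
- by move=> l; rewrite -etav subrr mxE.
Qed.

End Necessity.

(* [mu_lt_L] and [degree_N] exclude the two boundary cases mu = L and
   beta_N = gamma_N = 0, in which the SDP is always infeasible although
   quadratic Lyapunov functions can exist, so that the equivalence fails. *)
Theorem theorem2 (R : realType) (N : nat) (m : method R N) (mu L rho : R)
    (mu_gt0 : 0 < mu) (mu_lt_L : mu < L)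
    (rho_ge0 : 0 <= rho) (rho_lt1 : rho < 1)
    (alpha_neq0 : alpha m != 0)
    (gamma0_neq0 : gamma m ord0 != 0)
    (sum_beta : \sum_(j < N.+1) beta m j = 1)
    (sum_gamma : \sum_(j < N.+1) gamma m j = 1)
    (degree_N : beta m ord_max != 0 \/ gamma m ord_max != 0) :
  lyapunov_exists m mu L rho <-> rho_SDP_feasible m mu L rho.
Proof.
split; first exact: lyapunov_rho_SDP_feasible.
apply: rho_SDP_feasible_lyapunov => //; exact: lt_trans mu_lt_L.
Qed.
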